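(* Let $\mathcal{C}$ be a class of graphs closed under taking subgraphs. Then the following conditions are equivalent: (1) $\mathcal{C}$ is nowhere dense; (2) for all $r, k \in \mathbb{N}$ there is a constant $c$ such that for every $G \in \mathcal{C}$ and every $A \subseteq V(G)$ there is a $(k,r)$-cowitness for the pair $(A, G)$ of size at most $c$; (3) for all $r \in \mathbb{N}$ there is a constant $c$ such that for every $G \in \mathcal{C}$ there is a $(1,r)$-cowitness for the pair $(V(G), G)$ of size at most $c$.
   Context: Graphs are finite, simple and undirected; the length of a path is its number of edges. For $X \subseteq V(G)$, $N_r(X)$ denotes the set of vertices at distance at most $r$ from some vertex of $X$. A short path is a path of length at most $r$. A set $Q \subseteq V(G)$ captures a pair $(Y, z)$ (with $Y \subseteq V(G)$, $z \in V(G)$) if there is a short path connecting some $y \in Y$ with $z$ which contains some vertex of $Q$ (endpoints included). For $A \subseteq V(G)$, a $(k,r)$-cowitness for the pair $(A, G)$ is a set $Q \subseteq V(G)$ such that for every $X \subseteq A$ with $|X| = k$ and $A \subseteq N_r(X)$, and for every $a \in A$, the pair $(X, a)$ is captured by $Q$. A graph $H$ is an $r$-shallow minor of $G$ if there is a family $(B_h)_{h \in V(H)}$ of pairwise vertex-disjoint connected subgraphs of $G$, each of radius at most $r$, such that for every edge $uv$ of $H$ there are $u' \in B_u$, $v' \in B_v$ with $u'v' \in E(G)$. A class $\mathcal{C}$ is nowhere dense if for every $r$ there is $t$ such that $K_t$ is not an $r$-shallow minor of any $G \in \mathcal{C}$.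
   Formalization: In ''captures'', a short path may repeat vertices (a walk of length at most r); with simple paths the claim fails, since for stars with r = 2 the only path from a to a is trivial, so every (1,2)-cowitness for (V(G), G) is all of V(G) although stars are nowhere dense. *)

(* Defs.v *)
From mathcomp Require Import all_boot.

Set Implicit Arguments.
Unset Strict Implicit.
Unset Printing Implicit Defensive.

Record sgraph := SGraph {
  vertex :> finType;
  edge : rel vertex;
  edge_sym : symmetric edge;
  edge_irr : irreflexive edge }.

Record subgraph (G : sgraph) := Subgraph {
  sub_vertices : {set G};
  sub_edge : rel G;
  sub_edge_sym : symmetric sub_edge;
  sub_edgeW : forall x y : G, sub_edge x y ->
    [&& edge x y, x \in sub_vertices & y \in sub_vertices] }.

Section SubgraphAsGraph.
Variables (G : sgraph) (S : subgraph G).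

Definition sgraph_of_edge : rel {x : G | x \in sub_vertices S} :=
  fun x y => sub_edge S (val x) (val y).

Fact sgraph_of_edge_sym : symmetric sgraph_of_edge.
Proof. by move=> x y; exact: sub_edge_sym. Qed.

Fact sgraph_of_edge_irr : irreflexive sgraph_of_edge.
Proof.
by move=> x; apply/negP => /sub_edgeW/and3P[]; rewrite edge_irr.
Qed.

Definition sgraph_of : sgraph := SGraph sgraph_of_edge_sym sgraph_of_edge_irr.
End SubgraphAsGraph.

(* No isomorphism invariance is required of C. *)
Definition subgraph_closed (C : sgraph -> Prop) : Prop :=
  forall (G : sgraph) (S : subgraph G), C G -> C (sgraph_of S).

(* Vertices may repeat: in the notion of capturing below, "path" has to be
   read this way. If paths had to be simple, the only path from y to y would
   be the trivial one, so for the star K_{1,n}, whose vertices are pairwise at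
   distance at most 2, the only (1,2)-cowitness for (V(G), G) would be V(G),
   although stars form a nowhere dense class. For distances the two readings
   agree. *)
Definition path_between (G : sgraph) (x y : G) (p : seq G) : bool :=
  path (@edge G) x p && (last x p == y).

Definition dist_le (G : sgraph) (r : nat) (x y : G) : bool :=
  [exists n : 'I_r.+1, exists p : n.-tuple G, path_between x y p].

Lemma dist_leP (G : sgraph) (r : nat) (x y : G) :
  reflect (exists2 p : seq G, path_between x y p & size p <= r)
          (dist_le r x y).
Proof.
apply: (iffP existsP) => [[n /existsP[p xpy]] | [p xpy le_pr]].
  by exists p; rewrite // size_tuple -ltnS.
by exists (Ordinal (le_pr : size p < r.+1)); apply/existsP; exists (in_tuple p).
Qed.

Definition nbhd (G : sgraph) (r : nat) (X : {set G}) : {set G} :=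
  [set v | [exists x in X, dist_le r x v]].

Definition captures (G : sgraph) (r : nat) (Q Y : {set G}) (z : G) : Prop :=
  exists (y : G) (p : seq G),
    [/\ y \in Y, path_between y z p, size p <= r & has (mem Q) (y :: p)].

Definition cowitness (G : sgraph) (k r : nat) (A Q : {set G}) : Prop :=
  forall X : {set G}, X \subset A -> #|X| = k -> A \subset nbhd r X ->
  forall a : G, a \in A -> captures r Q X a.

Definition connected (G : sgraph) : Prop :=
  forall x y : G, connect (@edge G) x y.

(* In particular G is nonempty. *)
Definition radius_le (G : sgraph) (r : nat) : Prop :=
  exists c : G, forall v : G, dist_le r c v.

Definition shallow_minor (r : nat) (H G : sgraph) : Prop :=
  exists B : H -> subgraph G,
    [/\ forall u v : H, u != v ->
          [disjoint sub_vertices (B u) & sub_vertices (B v)],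
        forall u : H, connected (sgraph_of (B u)) /\
                      radius_le (sgraph_of (B u)) r
      & forall u v : H, edge u v ->
          exists u' v' : G, [/\ u' \in sub_vertices (B u),
                                v' \in sub_vertices (B v) & edge u' v']].

Fact complete_edge_sym (t : nat) : symmetric (fun i j : 'I_t => i != j).
Proof. by move=> i j; rewrite eq_sym. Qed.

Fact complete_edge_irr (t : nat) : irreflexive (fun i j : 'I_t => i != j).
Proof. by move=> i; rewrite eqxx. Qed.

Definition complete (t : nat) : sgraph :=
  SGraph (@complete_edge_sym t) (@complete_edge_irr t).

Definition nowhere_dense (C : sgraph -> Prop) : Prop :=
  forall r : nat, exists t : nat,
    forall G : sgraph, C G -> ~ shallow_minor r (complete t) G.

Definition bounded_cowitnesses (C : sgraph -> Prop) : Prop :=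
  forall r k : nat, exists c : nat,
    forall G : sgraph, C G -> forall A : {set G},
    exists Q : {set G}, cowitness k r A Q /\ #|Q| <= c.

Definition bounded_1_cowitnesses (C : sgraph -> Prop) : Prop :=
  forall r : nat, exists c : nat,
    forall G : sgraph, C G ->
    exists Q : {set G}, cowitness 1 r [set: G] Q /\ #|Q| <= c.

(* Main.v *)
Require Import Defs.
From mathcomp Require Import all_boot zify.
From Stdlib Require Import Classical_Prop.

(* (1) => (2). If small cowitnesses do not exist, one collects greedily pairs
   (X_i, a_i) not captured by chosen short paths from X_l to a_j, l, j < i.
   Nowhere dense classes are uniformly quasi-wide, so after deleting a bounded
   set S many a_i are pairwise far apart; a fixed X_l is then close in G - S to
   few of them, so that some chosen path meets S. Among pairs with the same
   distances to S, the vertex where it does captures every later pair.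

   (3) => (1). A large clique as a shallow minor yields a large clique with
   every edge replaced by a path of the same length l. In this subdivision every
   vertex is within distance l + l/2 of each branch vertex x, and the walks of
   this length from x to the middle of the path between branch vertices y and z
   stay in the subdivided triangle xyz; disjoint triangles must all be hit. *)

Set Implicit Arguments.
Unset Strict Implicit.
Unset Printing Implicit Defensive.

(** * Ramsey and pigeonhole arguments *)

(** The order of quantifiers governs (1) => (2): the bound on [#|S|] must be fixed before the number
    of far-apart vertices is asked for, because that number has to exceed the count of profiles,
    which depends on the bound. Quasi-wideness is therefore proved by enlarging the balls one unit
    at a time, where each enlargement deletes a number of vertices that depends only on the clique
    excluded at the next depth.

    In (3) => (1) the radius must leave no slack: a walk with two spare steps could step out of its
    triangle and back, and an outside vertex could then capture the pair. Hence all paths need one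
    common length l, the radius is tied to l, and one bound c has to serve every possible l, since l
    is known only after Ramsey's theorem. Closure under subgraphs makes the subdivision itself a
    member of the class. *)

Lemma ramsey (m n : nat) : exists N, forall (T : eqType) (R : rel T) (s : seq T),
  N <= size s ->
  (exists s', [/\ subseq s' s, size s' = m & pairwise R s']) \/
  (exists s', [/\ subseq s' s, size s' = n & pairwise (fun x y => ~~ R x y) s']).
Proof.
have [k] := ubnP (m + n); elim: k m n => // k IHk [|m] n.
  by move=> _; exists 0 => T R s _; left; exists [::]; rewrite sub0seq.
case: n => [|n] ltk.
  by exists 0 => T R s _; right; exists [::]; rewrite sub0seq.
have [N1 H1] := IHk m n.+1 ltac:(lia).
have [N2 H2] := IHk m.+1 n ltac:(lia).
exists (N1 + N2).+1 => T R [|x s] //=; rewrite ltnS => les.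
have consS (a : pred T) s' : subseq s' (filter a s) -> subseq (x :: s') (x :: s).
  by move=> h; rewrite /= eqxx; exact: subseq_trans h (filter_subseq _ _).
have consA (a : pred T) s' : subseq s' (filter a s) -> all a s'.
  move=> /mem_subseq h; apply/allP => y /h.
  by rewrite mem_filter => /andP[].
have [le1|lt1] := leqP N1 (size (filter (R x) s)).
  case: (H1 T R _ le1) => [[s' [sub sz pw]]|[s' [sub sz pw]]].
    left; exists (x :: s'); split; [exact: consS sub|by rewrite /= sz|].
    by rewrite pairwise_cons pw (consA _ _ sub).
  by right; exists s'; split=> //; exact: subseq_trans sub (subseq_trans (filter_subseq _ _) (subseq_cons _ _)).
have le2 : N2 <= size (filter (fun y => ~~ R x y) s).
  have := count_predC (R x) s; rewrite !size_filter in lt1 *.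
  rewrite (eq_count (a1 := predC _) (a2 := fun y => ~~ R x y)) //. lia.
case: (H2 T R _ le2) => [[s' [sub sz pw]]|[s' [sub sz pw]]].
  by left; exists s'; split=> //; exact: subseq_trans sub (subseq_trans (filter_subseq _ _) (subseq_cons _ _)).
right; exists (x :: s'); split; [exact: consS sub|by rewrite /= sz|].
by rewrite pairwise_cons pw (consA _ _ sub).
Qed.

(** Colours are removed one at a time. [pairwise] reads [f] from earlier to later entries, so [f]
    may be asymmetric, as the sizes of [q i j] may be later on. *)
Lemma ramsey_colors (L n : nat) :
  exists N, forall (T : eqType) (f : T -> T -> nat) (s : seq T),
  N <= size s -> pairwise (fun x y => f x y < L) s ->
  exists k s', [/\ k < L, subseq s' s, size s' = n &
                   pairwise (fun x y => f x y == k) s'].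
Proof.
(* With no colour left, two entries already contradict the hypothesis; fewer would satisfy it
   vacuously. *)
elim: L => [|L [N IHN]]; first by exists 2 => T f [|x [|y s]].
have [M HM] := ramsey n N.
exists M => T f s les pws.
case: (HM T (fun x y => f x y == L) s les) => [[s' [sub sz pw]]|[s' [sub sz pw]]].
  by exists L, s'.
case: (IHN T f s') => [||k [s2 [ltk sub2 sz2 pw2]]]; first by rewrite sz.
  have := subseq_pairwise sub pws.
  elim: s' pw {sub sz} => //= x s' IH /andP[/allP a1 p1] /andP[/allP a2 p2].
  rewrite IH // andbT; apply/allP => y ys; move: (a1 y ys) (a2 y ys); lia.
by exists k, s2; split=> //; [lia | exact: subseq_trans sub2 sub].
Qed.

Lemma pigeonhole (T Y : eqType) (P : T -> Y -> bool) (ys : seq Y) (s : seq T)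
    (M : nat) :
  (forall x, x \in s -> has (P x) ys) -> size ys * M < size s ->
  exists2 y, y \in ys & M < count (P^~ y) s.
Proof.
elim: ys s => [|y ys IH] s hP /= lts.
  by case: s hP lts => //= x s /(_ x (mem_head _ _)).
have [ltM|leM] := ltnP M (count (P^~ y) s).
  by exists y => //; rewrite mem_head.
case: (IH (filter (fun x => ~~ P x y) s)) => [x||y' y's lt'].
- by rewrite mem_filter => /andP[nP /hP] /=; rewrite (negPf nP).
- have := count_predC (P^~ y) s; rewrite size_filter.
  by rewrite (eq_count (a1 := predC _) (a2 := fun x => ~~ P x y)) //; lia.
exists y'; rewrite ?in_cons ?y's ?orbT //.
apply: leq_trans lt' _; rewrite count_filter; apply: sub_count => x /=.
by case/andP.
Qed.

(** The greedy case of Hall's theorem: no list can be exhausted by the other indices. *)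
Lemma distinct_representatives (J T : finType) (L : J -> {set T}) :
  (forall j, #|J| <= #|L j|) ->
  exists2 f : J -> T, injective f & forall j, f j \in L j.
Proof.
move=> leL.
have /fin_all_exists[f0 Hf0] : forall j, exists x, x \in L j.
  move=> j; apply/card_gt0P; apply: leq_trans (leL j).
  by apply/card_gt0P; exists j.
suff [f injf fL] : exists2 f : J -> T, {in enum J &, injective f}
    & forall j, f j \in L j.
  by exists f => // x y; apply: injf; rewrite mem_enum.
have: size (enum J) <= #|J| by rewrite cardE.
elim: (enum J) => [|j js IH] /= szj; first by exists f0.
have [f injf fL] := IH (ltnW szj).
have [jjs|jnjs] := boolP (j \in js).
  by exists f => // x y; rewrite !in_cons => /predU1P[->|xj] /predU1P[->|yj] //; apply: injf.
have [x /setDP[xL xn]] : exists x, x \in L j :\: [set:: map f js].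
  apply/card_gt0P; rewrite cardsD subn_gt0.
  apply: leq_ltn_trans (leq_trans szj (leL j)).
  apply: leq_trans (subset_leq_card (subsetIr _ _)) _.
  rewrite cardsE; apply: leq_trans (card_size _) _; by rewrite size_map.
exists (fun k => if k == j then x else f k); last by move=> k; case: eqP => // ->.
have xf k : k \in js -> x <> f k.
  by move=> kj e; move: xn; rewrite inE e map_f.
move=> a b; rewrite !in_cons; case: (eqVneq a j) => [->|naj] /=;
  case: (eqVneq b j) => [->|nbj] //= aj bj e; first by case: (xf _ bj).
  by case: (xf _ aj).
exact: injf.
Qed.

(** * Cliques contracted from stars, or a small separator *)

Section StarModel.
Variables (I : eqType) (T : finType) (N : I -> {set T}).

Definition linked (p q : I * {set T}) : bool :=
  [&& p.1 != q.1, [disjoint p.2 & q.2] &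
      (p.2 :&: N q.1 != set0) || (q.2 :&: N p.1 != set0)].

(* If W is contracted onto a for each (a, W) in s, the a's become a clique. *)
Definition star_model (A : seq I) (s : seq (I * {set T})) : bool :=
  all (fun p : I * {set T} => (p.1 \in A) && (p.2 \subset N p.1)) s
  && pairwise linked s.

(* Each star takes its leaves among the common neighbours with the stars that
   were chosen before, so that only later candidates have to be discarded. *)
Lemma star_model_greedy (f t : nat) (W : {set T}) (K : seq I) :
  uniq K -> pairwise (fun a b => ~~ (N a :&: N b \subset W)) K ->
  (forall w, w \notin W -> count (fun a => w \in N a) K <= f) ->
  t * (t * f).+1 <= size K ->
  exists2 s, size s = t & star_model K s.
Proof.
move=> uK pK degK szK.
(* New leaves will lie in [N b] for their centre [b], so keeping old leaves off [N b] keeps the leaf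
   sets disjoint. The second conjunct supplies the vertex outside [W] that links the two stars. *)
pose fresh (K' : seq I) (p : I * {set T}) := all (fun b =>
  [&& p.1 != b, ~~ (N p.1 :&: N b \subset W) & [disjoint p.2 & N b]]) K'.
suff [s [K' [szs _ _ mods _]]] : exists s K',
    [/\ size s = t, subseq K' K, size K <= size K' + t * (t * f).+1,
        star_model K s & all (fresh K') s].
  by exists s.
have: t <= t by [].
(* Only the number of stars varies in the induction; the cost per star stays [(t * f).+1]: the
   centre, and for each of at most [t] leaves at most [f] candidates adjacent to it. *)
elim: {1 3 4}t => [|j IHj] ltj.
  by exists [::], K; rewrite mul0n addn0.
have [s [[|a K'] [szs sub szK' /andP[alls pws] /allP allf]]] := IHj (ltnW ltj).
  have : j.+1 * (t * f).+1 <= t * (t * f).+1 by rewrite leq_mul2r ltj orbT.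
  move: szK'; rewrite /=; lia.
have aK : a \in K by apply: (mem_subseq sub); rewrite mem_head.
have [naK uK'] : a \notin K' /\ uniq K'.
  by apply/andP; have := subseq_uniq sub uK.
have /andP[/allP pa pK'] : pairwise (fun a b => ~~ (N a :&: N b \subset W)) (a :: K').
  exact: subseq_pairwise sub pK.
pose ws := pmap (fun p : I * {set T} => [pick x in (N p.1 :&: N a) :\: W]) s.
have wsP w : w \in ws -> (w \in N a) && (w \notin W).
  rewrite mem_pmap => /mapP[p _]; case: pickP => // x + [->].
  by rewrite !inE => /and3P[-> _ ->].
have szws : size ws <= t.
  by rewrite size_pmap; apply: leq_trans (count_size _ _) _; rewrite szs ltnW.
exists ((a, [set:: ws]) :: s), (filter (fun b => [disjoint [set:: ws] & N b]) K').
split.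
- by rewrite /= szs.
- exact: subseq_trans (filter_subseq _ _) (subseq_trans (subseq_cons _ _) sub).
- apply: leq_trans szK' _; rewrite /= mulSn.
  suff: count (fun b => ~~ [disjoint [set:: ws] & N b]) K' <= t * f.
    have := count_predC (fun b => [disjoint [set:: ws] & N b]) K'; rewrite size_filter.
    rewrite (eq_count (a1 := predC _) (a2 := fun b => ~~ [disjoint [set:: ws] & N b])) //.
    by rewrite addnA leq_add2r => <- le1; rewrite addnS ltnS leq_add2l.
  rewrite leqNgt -size_filter; apply/negP => big.
  have [b||w wws] := @pigeonhole _ _ (fun b w => w \in N b) ws
    (filter (fun b => ~~ [disjoint [set:: ws] & N b]) K') f.
  + rewrite mem_filter => /andP[/pred0Pn[w /andP[/=]]].
    by rewrite inE => ww wN _; apply/hasP; exists w.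
  + by apply: leq_ltn_trans big; rewrite leq_mul2r szws orbT.
  + rewrite ltnNge => /negP; apply.
    have /andP[_ /degK] := wsP _ wws; apply: leq_trans.
    apply: leq_count_subseq; apply: subseq_trans (filter_subseq _ _) _.
    exact: subseq_trans (subseq_cons _ _) sub.
- rewrite /star_model /= aK alls pws !andbT /=; apply/andP; split.
    by apply/subsetP => w; rewrite inE => /wsP /andP[].
  apply/allP => p ps; have /andP[/and3P[pa1 pa2 pa3] _] := allf p ps.
  rewrite /linked /= eq_sym pa1 /=; apply/andP; split.
    rewrite disjoint_sym; apply: disjointWr pa3.
    by apply/subsetP => w; rewrite inE => /wsP /andP[].
  apply/orP; left; apply/set0Pn; move: (pa2) => /subsetPn[x xI xW].
  case E: [pick x in (N p.1 :&: N a) :\: W] => [y|]; last first.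
    by move: E; case: pickP => // /(_ x); rewrite inE xW xI.
  exists y; rewrite !inE; apply/andP; split.
    by rewrite mem_pmap -E (map_f (fun p : I * {set T} => [pick x in (N p.1 :&: N a) :\: W]) ps).
  by move: E; case: pickP => // z + [<-]; rewrite !inE => /and3P[_ ->].
- apply/andP; split; last first.
    apply/allP => p ps; have /andP[_ /allP h] := allf p ps.
    by apply/allP => b; rewrite mem_filter => /andP[_ /h].
  apply/allP => b; rewrite mem_filter => /andP[db bK'] /=.
  by rewrite db pa // !andbT; apply: contraNneq naK => ->.
Qed.

(** In a complete bipartite graph a perfect matching suffices: the single leaf of each star is
    adjacent to every other centre. *)
Lemma star_model_biclique (A : seq I) (ws : seq T) :
  uniq A -> uniq ws -> size A = size ws ->
  (forall a w, a \in A -> w \in ws -> w \in N a) ->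
  exists2 s, size s = size ws & star_model A s.
Proof.
move=> uA uws sz h.
suff [s [szs mods _]] : exists s, [/\ size s = size ws, star_model A s
    & all (fun p : I * {set T} => p.2 \subset [set:: ws]) s] by exists s.
elim: ws A uA uws sz h => [|w ws IH] [|a A] //=; first by exists [::].
move=> /andP[aA uA] /andP[wws uws] [sz] h.
have [|s [szs /andP[/allP alls pws] /allP subs]] := IH A uA uws sz.
  by move=> b v bA vws; apply: h; rewrite in_cons ?bA ?vws orbT.
exists ((a, [set w]) :: s); split; first by rewrite /= szs.
  rewrite /star_model /= pws sub1set mem_head h ?mem_head //= andbT.
  apply/andP; split; apply/allP => p ps; have /andP[pA pN] := alls p ps.
    by rewrite pN in_cons pA orbT.
  rewrite /linked /=; apply/and3P; split.
  - by apply: contraNneq aA => ->.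
  - rewrite disjoints1; apply: contra wws => wp.
    by have /subsetP/(_ w wp) := subs p ps; rewrite inE.
  - apply/orP; left; apply/set0Pn; exists w.
    by rewrite !inE eqxx h ?mem_head // in_cons pA orbT.
apply/andP; split; first by rewrite sub1set !inE eqxx.
apply/allP => p ps; apply: subset_trans (subs p ps) _.
by apply/subsetP => x; rewrite !inE => ->; rewrite orbT.
Qed.

Lemma star_modelW (A B : seq I) s :
  {subset A <= B} -> star_model A s -> star_model B s.
Proof.
move=> sAB /andP[/allP alls pws]; rewrite /star_model pws andbT.
by apply/allP => p /alls /andP[/sAB -> ->].
Qed.

End StarModel.

(** A vertex common to many [N a] is put into the separator, and only those [a] are kept. After [t]
    such vertices there is a biclique. If the process stops earlier, outside vertices have small
    degree, and Ramsey gives either the separated family or a family to which the greedy choice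
    applies. *)
Lemma star_model_or_separator (t m : nat) :
  exists n, forall (I : eqType) (T : finType) (N : I -> {set T}) (A : seq I),
  uniq A -> n <= size A ->
  (exists2 s, size s = t & star_model N A s) \/
  (exists (W : {set T}) B, [/\ #|W| <= t, subseq B A, size B = m,
     forall a w, a \in B -> w \in W -> w \in N a &
     pairwise (fun a b => N a :&: N b \subset W) B]).
Proof.
(* [ws] is the separator built so far and [u] the number of vertices it may still receive. *)
suff step u : u <= t -> exists n, forall (I : eqType) (T : finType)
    (N : I -> {set T}) (A : seq I) (ws : seq T),
    uniq A -> uniq ws -> size ws + u = t ->
    (forall a w, a \in A -> w \in ws -> w \in N a) -> n <= size A ->
    (exists2 s, size s = t & star_model N A s) \/
    (exists (W : {set T}) B, [/\ #|W| <= t, subseq B A, size B = m,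
       forall a w, a \in B -> w \in W -> w \in N a &
       pairwise (fun a b => N a :&: N b \subset W) B]).
  have [n hn] := step t (leqnn t); exists n => I T N A uA lenA.
  by apply: (hn _ _ _ _ [::]).
elim: u => [|u IHu] leu.
  exists t => I T N A ws uA uws; rewrite addn0 => sz h leA; left.
  have [||||s szs mods] := @star_model_biclique I T N (take t A) ws.
  - exact: take_uniq.
  - by [].
  - by rewrite size_takel.
  - by move=> a w /mem_take; exact: h.
  exists s; first by rewrite szs.
  by apply: star_modelW mods => a /mem_take.
have [f hf] := IHu (ltnW leu).
have [n hn] := ramsey m (t * (t * f).+1).
exists n => I T N A ws uA uws sz h leA.
have [/existsP[w /andP[wws ltf]]|none] :=
    boolP [exists w : T, (w \notin ws) && (f <= count (fun a => w \in N a) A)].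
  have [|||||[s szs mods]|[W [B [szW subB szB BW pB]]]] :=
      hf I T N (filter (fun a => w \in N a) A) (w :: ws).
  - exact: filter_uniq.
  - by rewrite /= wws.
  - by rewrite /= addSnnS.
  - move=> a v; rewrite mem_filter => /andP[wN aA].
    by rewrite in_cons => /predU1P[->|/h->].
  - by rewrite size_filter.
  - left; exists s => //; apply: star_modelW mods => a.
    by rewrite mem_filter => /andP[].
  right; exists W, B; split=> //.
  exact: subseq_trans subB (filter_subseq _ _).
have [[B [subB szB pB]]|[K [subK szK pK]]] :=
    hn I (fun a b => N a :&: N b \subset [set:: ws]) A leA.
  right; exists [set:: ws], B; split=> //.
    by rewrite cardsE; apply: leq_trans (card_size _) _; rewrite -sz leq_addr.
  by move=> a w aB; rewrite inE; apply: h; apply: (mem_subseq subB).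
have [|||s szs mods] := @star_model_greedy I T N f t [set:: ws] K _ pK.
- exact: subseq_uniq subK uA.
- move=> w; rewrite inE => wws; apply: leq_trans (leq_count_subseq _ subK) _.
  by move/existsPn: none => /(_ w); rewrite wws /= -ltnNge => /ltnW.
- by rewrite szK.
by left; exists s => //; apply: star_modelW mods; exact: mem_subseq.
Qed.

(** * Shallow clique minors as families of sets *)

Section Reach.
Variable G : sgraph.
Implicit Types (U : {set G}) (x y z : G) (d : nat).

(** Bounded distance inside the induced subgraph on [U], kept in the type [G] so that walks in
    different branch sets can be concatenated. *)
Definition reach U d x y : Prop :=
  exists p, [/\ path (@edge G) x p, last x p = y, size p <= d & all (mem U) (x :: p)].

Lemma reach_refl U d x : x \in U -> reach U d x x.
Proof. by move=> xU; exists [::]; rewrite /= xU. Qed.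

Lemma reach_edge U x y : x \in U -> y \in U -> edge x y -> reach U 1 x y.
Proof. by move=> xU yU exy; exists [:: y]; rewrite /= exy xU yU. Qed.

Lemma reachW U U' d d' x y : U \subset U' -> d <= d' ->
  reach U d x y -> reach U' d' x y.
Proof.
move=> /subsetP sU led [p [xp lp szp /allP pU]]; exists p; split=> //.
  exact: leq_trans szp led.
by apply/allP => v /pU; exact: sU.
Qed.

Lemma reach_trans U d d' x y z :
  reach U d x y -> reach U d' y z -> reach U (d + d') x z.
Proof.
move=> [p [xp lp szp pU]] [q [yq lq szq /andP[_ qU]]]; exists (p ++ q); split.
- by rewrite cat_path xp lp.
- by rewrite last_cat lp.
- by rewrite size_cat leq_add.
- by rewrite -cat_cons all_cat pU.
Qed.

Lemma reach_sym U d x y : reach U d x y -> reach U d y x.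
Proof.
move=> [p [xp lp szp /allP pU]]; exists (rev (belast x p)); split.
- rewrite -lp rev_path; apply: sub_path xp => a b; by rewrite edge_sym.
- by case: p {xp szp pU} lp => //= a p _; rewrite rev_cons last_rcons.
- by rewrite size_rev size_belast.
- rewrite -lp -rev_rcons -lastI all_rev; exact/allP.
Qed.

End Reach.

Section InducedSubgraph.
Variables (G : sgraph) (U : {set G}).

Definition induced_edge : rel G := fun x y => [&& edge x y, x \in U & y \in U].

Fact induced_edge_sym : symmetric induced_edge.
Proof. by move=> x y; rewrite /induced_edge edge_sym (andbC (x \in U)). Qed.

Definition induced : subgraph G := Subgraph induced_edge_sym (fun x y h => h).

Lemma induced_path (x : sgraph_of induced) (p : seq G) :
  path (@edge G) (val x) p -> all (mem U) p ->
  exists2 p' : seq (sgraph_of induced), path (@edge _) x p' & map val p' = p.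
Proof.
elim: p x => [|y p IH] x /=; first by exists [::].
move=> /andP[exy yp] /andP[yU pU].
have [p' yp' <-] := IH (Sub y yU) yp pU.
exists (Sub y yU :: p') => //=; rewrite yp' andbT.
by rewrite /sgraph_of_edge /= /induced_edge exy yU (valP x).
Qed.

Lemma induced_dist_le d (x y : sgraph_of induced) :
  reach U d (val x) (val y) -> dist_le d x y.
Proof.
move=> [p [xp lp szp /andP[_ pU]]]; have [p' xp' ep] := induced_path xp pU.
apply/dist_leP; exists p'; last by rewrite -(size_map val) ep.
by rewrite /path_between xp' /= -val_eqE -last_map ep lp.
Qed.

End InducedSubgraph.

Lemma shallow_minor_of_sets (G : sgraph) (r t : nat) (U : 'I_t -> {set G})
    (c : 'I_t -> G) :
  (forall i j, i != j -> [disjoint U i & U j]) ->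
  (forall i, c i \in U i) ->
  (forall i v, v \in U i -> reach (U i) r (c i) v) ->
  (forall i j : 'I_t, i < j -> exists u v, [/\ u \in U i, v \in U j & edge u v]) ->
  shallow_minor r (complete t) G.
Proof.
move=> disU cU reachU adjU; exists (fun i => induced (U i)); split.
- exact: disU.
- move=> i.
  have toc (v : sgraph_of (induced (U i))) :
      dist_le r (Sub (c i) (cU i) : sgraph_of (induced (U i))) v.
    exact/induced_dist_le/reachU/(valP v).
  split; last by exists (Sub (c i) (cU i)).
  have con (v : sgraph_of (induced (U i))) :
      connect (@edge (sgraph_of (induced (U i)))) (Sub (c i) (cU i)) v.
    by have /dist_leP[p /andP[pp /eqP<-] _] := toc v; apply/connectP; exists p.
  move=> x y; apply: connect_trans (con y).
  by rewrite (sym_connect_sym (@edge_sym _)); exact: con.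
- move=> i j /=; rewrite neq_ltn => /orP[] /adjU[u [v [uU vU euv]]].
    by exists u, v.
  by exists v, u; rewrite edge_sym.
Qed.

Lemma sets_of_shallow_minor (G : sgraph) (r t : nat) :
  shallow_minor r (complete t) G ->
  exists (U : 'I_t -> {set G}) (c : 'I_t -> G),
  [/\ forall i j, i != j -> [disjoint U i & U j],
      forall i, c i \in U i,
      forall i v, v \in U i -> reach (U i) r (c i) v &
      forall i j : 'I_t, i != j -> exists u v, [/\ u \in U i, v \in U j & edge u v]].
Proof.
move=> [B [disB radB adjB]].
have /fin_all_exists[c Hc] : forall i : 'I_t, exists c,
    c \in sub_vertices (B i) /\
    forall v, v \in sub_vertices (B i) -> reach (sub_vertices (B i)) r c v.
  move=> i; have [_ [c Hc]] := radB i; exists (val c); split=> [|v vU].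
    exact: valP.
  have /dist_leP[p /andP[cp /eqP lp] szp] := Hc (Sub v vU).
  exists (map val p); split.
  - by apply: homo_path cp => a b /sub_edgeW; case/and3P.
  - by rewrite last_map lp.
  - by rewrite size_map.
  - by apply/allP => w; rewrite -map_cons => /mapP[z _ ->]; exact: valP.
by exists (fun i => sub_vertices (B i)), c; split=> // i; case: (Hc i).
Qed.

(** * Uniform quasi-wideness *)

Lemma pairwise_tnth (T : Type) (R : rel T) n (s : n.-tuple T) (i j : 'I_n) :
  pairwise R s -> i < j -> R (tnth s i) (tnth s j).
Proof.
have x0 := tnth s i; move=> /(pairwiseP x0) h ltij; rewrite !(tnth_nth x0).
by apply: h; rewrite ?inE ?size_tuple.
Qed.

Lemma pairwise_sym_in (T : eqType) (R : rel T) (s : seq T) (x y : T) :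
  symmetric R -> pairwise R s -> x \in s -> y \in s -> x != y -> R x y.
Proof.
move=> symR; elim: s => //= a s IH /andP[/allP ha hs].
rewrite !in_cons => /predU1P[->|xs] /predU1P[->|ys] nxy; rewrite ?eqxx // in nxy *.
- exact: ha.
- by rewrite symR; exact: ha.
- exact: IH.
Qed.

Section Ball.
Variable G : sgraph.
Implicit Types (S : {set G}) (a v : G).

(* The ball of radius i around a in G - S; empty if a is in S. *)
Fixpoint ball S (i : nat) a : {set G} :=
  if i is j.+1 then
    ball S j a :|: [set v | (v \notin S) && [exists u in ball S j a, edge u v]]
  else [set a] :\: S.

Lemma ballS S i a : ball S i a \subset ball S i.+1 a.
Proof. exact: subsetUl. Qed.

Lemma ball_leq S i j a : i <= j -> ball S i a \subset ball S j a.
Proof.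
elim: j => [|j IH]; first by rewrite leqn0 => /eqP->.
rewrite leq_eqVlt => /predU1P[->//|/IH h]; exact: subset_trans h (ballS _ _ _).
Qed.

Lemma ball_anti S S' i a : S \subset S' -> ball S' i a \subset ball S i a.
Proof.
move=> sS; elim: i => [|i /subsetP IH] /=; first exact: setDS.
apply: setUSS; first exact/subsetP.
apply/subsetP => v; rewrite !inE => /andP[vS /existsP[u /andP[/IH uB euv]]].
rewrite (contra (subsetP sS v) vS) /=; apply/existsP; exists u.
by rewrite uB.
Qed.

Lemma ball_center S i a : a \notin S -> a \in ball S i a.
Proof.
by move=> aS; apply: (subsetP (ball_leq S a (leq0n i))); rewrite !inE aS eqxx.
Qed.

Lemma ball_reach S i a v : v \in ball S i a -> reach (ball S i a) i a v.
Proof.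
elim: i v => [|i IH] v.
  move=> vB; have /setDP[/set1P e _] := vB.
  by rewrite e in vB *; exact: reach_refl.
move=> vB; move: (vB); rewrite /= in_setU => /orP[/IH|].
  by apply: reachW; rewrite ?subsetUl.
rewrite inE => /andP[vS /existsP[u /andP[uB euv]]].
rewrite -addn1; apply: reach_trans (reach_edge _ vB euv).
  by apply: reachW (IH _ uB); rewrite ?subsetUl.
by rewrite (subsetP (ballS _ _ _)).
Qed.

Lemma reach_ball S d a v : reach (~: S) d a v -> v \in ball S d a.
Proof.
move=> [p [+ <- szp +]]; move=> pp pS.
apply: (subsetP (ball_leq S a szp)).
elim/last_ind: p pp pS {szp} => [|p w IH] /=.
  by rewrite !inE eqxx !andbT.
rewrite rcons_path last_rcons all_rcons size_rcons => /andP[pp ew].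
move=> /and3P[aS wS pS].
have {}wS : w \notin S by rewrite -in_setC.
rewrite /= !inE; apply/orP; right; rewrite wS /=.
by apply/existsP; exists (last a p); rewrite ew IH //= aS.
Qed.

(** What the ball gains when its radius grows by one. Balls that are disjoint and not adjacent can,
    after this growth, meet only in common elements of these sets. *)
Definition outer_nbhd S i a : {set G} :=
  [set w | [&& w \notin S, w \notin ball S i a & [exists u in ball S i a, edge u w]]].

Definition adjacent (X Y : {set G}) : bool :=
  [exists u in X, exists v in Y, edge u v].

Lemma adjacentP (X Y : {set G}) :
  reflect (exists u v, [/\ u \in X, v \in Y & edge u v]) (adjacent X Y).
Proof.
apply: (iffP existsP) => [[u /andP[uX /existsP[v /andP[vY e]]]]|[u [v [uX vY e]]]].
  by exists u, v.
by exists u; rewrite uX; apply/existsP; exists v; rewrite vY.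
Qed.

Lemma adjacent_sym : symmetric adjacent.
Proof.
by move=> X Y; apply/adjacentP/adjacentP => -[u [v [uX vY e]]];
  exists v, u; rewrite edge_sym.
Qed.

End Ball.

Lemma clique_minor_of_balls (G : sgraph) (r i : nat) (S : {set G}) (A : seq G) :
  i <= r -> all [pred a | a \notin S] A ->
  pairwise (fun a b => [disjoint ball S i a & ball S i b]) A ->
  pairwise (fun a b => adjacent (ball S i a) (ball S i b)) A ->
  shallow_minor r (complete (size A)) G.
Proof.
move=> leir /allP AS dis adj; pose x := tnth (in_tuple A).
apply: (@shallow_minor_of_sets _ _ _ (fun l => ball S i (x l)) x).
- move=> l k; rewrite neq_ltn => /orP[] lt.
    exact: (pairwise_tnth (s := in_tuple A) dis lt).
  by rewrite disjoint_sym; exact: (pairwise_tnth (s := in_tuple A) dis lt).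
- by move=> l; apply/ball_center/AS; rewrite mem_tnth.
- by move=> l v /ball_reach; exact: reachW.
- by move=> l k lt; apply/adjacentP; exact: (pairwise_tnth (s := in_tuple A) adj lt).
Qed.

(** The branch sets are the balls together with their leaves, whence radius [i.+1]. A leaf of one
    ball is in no other ball, as the balls would then be adjacent. *)
Lemma clique_minor_of_star_model (G : sgraph) (i : nat) (S : {set G})
    (A : seq G) s :
  all [pred a | a \notin S] A ->
  pairwise (fun a b => [disjoint ball S i a & ball S i b]) A ->
  pairwise (fun a b => ~~ adjacent (ball S i a) (ball S i b)) A ->
  star_model (outer_nbhd S i) A s ->
  shallow_minor i.+1 (complete (size s)) G.
Proof.
move=> /allP AS dis nadj /andP[/allP alls pws].
pose x l := (tnth (in_tuple s) l).1; pose W l := (tnth (in_tuple s) l).2.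
have xA l : x l \in A by have /andP[] := alls _ (mem_tnth l (in_tuple s)).
have WN l : W l \subset outer_nbhd S i (x l).
  by have /andP[] := alls _ (mem_tnth l (in_tuple s)).
have lnk (l k : 'I_(size s)) : l < k -> linked (outer_nbhd S i) (x l, W l) (x k, W k).
  move=> lt; have := pairwise_tnth (s := in_tuple s) pws lt.
  by rewrite /x /W -!surjective_pairing.
have WP l w : w \in W l -> exists2 u, u \in ball S i (x l) & edge u w.
  move/(subsetP (WN l)); rewrite inE => /and3P[_ _ /existsP[u /andP[]]].
  by exists u.
have xinj (l k : 'I_(size s)) : l < k -> x l != x k by move/lnk/and3P=> [].
have nad l k w : x l != x k -> w \in W l -> w \notin ball S i (x k).
  move=> ne /WP[u uB euw]; apply/negP => wB.
  have symn : symmetric (fun a b => ~~ adjacent (ball S i a) (ball S i b)).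
    by move=> a b; rewrite adjacent_sym.
  have /adjacentP := pairwise_sym_in symn nadj (xA l) (xA k) ne.
  by apply; exists u, w.
have disB l k : x l != x k -> [disjoint ball S i (x l) & ball S i (x k)].
  have symd : symmetric (fun a b => [disjoint ball S i a & ball S i b]).
    by move=> a b; rewrite disjoint_sym.
  exact: pairwise_sym_in symd dis (xA l) (xA k).
apply: (@shallow_minor_of_sets _ _ _ (fun l => ball S i (x l) :|: W l) x).
- suff dis_lt (l k : 'I_(size s)) : l < k ->
      [disjoint ball S i (x l) :|: W l & ball S i (x k) :|: W k].
    move=> l k; rewrite neq_ltn => /orP[/dis_lt//|/dis_lt].
    by rewrite disjoint_sym.
  move=> lt; have ne := xinj _ _ lt; have /and3P[_ dW _] := lnk _ _ lt.
  rewrite -setI_eq0; apply/eqP/setP => w; rewrite !inE; apply/negbTE/negP.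
  move=> /andP[/orP[wl|wl] /orP[wk|wk]].
  + by rewrite (disjointFr (disB _ _ ne) wl) in wk.
  + by have := nad k l w; rewrite eq_sym wl => /(_ ne wk).
  + by have := nad l k w; rewrite wk => /(_ ne wl).
  + by rewrite (disjointFr dW wl) in wk.
- by move=> l; rewrite inE ball_center //; apply: AS.
- move=> l v; rewrite inE => /orP[/ball_reach|vW].
    by apply: reachW; rewrite ?subsetUl.
  have [u uB euv] := WP _ _ vW.
  rewrite -addn1; apply: reach_trans (reach_edge _ _ euv).
  + by apply: reachW (ball_reach uB); rewrite ?subsetUl.
  + by rewrite inE uB.
  + by rewrite inE vW orbT.
- move=> l k /lnk /and3P[_ _ /orP[]] /set0Pn[w]; rewrite inE => /andP[/= wW];
    rewrite inE => /and3P[_ _ /existsP[u /andP[uB euw]]].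
    by exists w, u; split; rewrite ?inE ?wW ?uB ?orbT // edge_sym.
  by exists u, w; split; rewrite ?inE ?wW ?uB ?orbT.
Qed.

(** Many pairwise adjacent balls would form a clique minor, so many are pairwise non-adjacent. Their
    outer neighbourhoods cannot carry a star model either, and the resulting separator is what gets
    deleted. *)
Lemma quasi_wide_step (i t m : nat) : exists n, forall (G : sgraph),
  ~ shallow_minor i.+1 (complete t) G -> forall (S : {set G}) (A : seq G),
  uniq A -> n <= size A -> all [pred a | a \notin S] A ->
  pairwise (fun a b => [disjoint ball S i a & ball S i b]) A ->
  exists (S' : {set G}) B, [/\ subseq B A, size B = m, #|S'| <= #|S| + t,
    all [pred a | a \notin S'] B &
    pairwise (fun a b => [disjoint ball S' i.+1 a & ball S' i.+1 b]) B].
Proof.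
have [n1 hn1] := star_model_or_separator t m.
have [n hn] := ramsey t n1.
exists n => G nominor S A uA leA AS dis.
have [[K [subK szK pK]]|[K [subK szK pK]]] :=
    hn _ (fun a b => adjacent (ball S i a) (ball S i b)) A leA.
  case: nominor; rewrite -szK; apply: clique_minor_of_balls pK => //.
    by apply/allP => a /(mem_subseq subK); exact/allP.
  exact: subseq_pairwise subK dis.
have uK := subseq_uniq subK uA.
have KS : all [pred a | a \notin S] K.
  by apply/allP => a /(mem_subseq subK); exact/allP.
have disK := subseq_pairwise subK dis.
have [|[s szs mods]|[W [B [szW subB szB BW pB]]]] :=
    hn1 _ _ (outer_nbhd S i) K uK.
- by rewrite szK.
- by case: nominor; rewrite -szs; apply: clique_minor_of_star_model mods.
exists (S :|: W), B; split=> //.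
- exact: subseq_trans subB subK.
- by rewrite cardsU; lia.
(* Every [a] in [B] has all of [W] among its outer neighbours, and no centre is an outer neighbour
   of its own ball. *)
- apply/allP => a aB /=; have aS : a \notin S := allP KS a (mem_subseq subB aB).
  rewrite inE negb_or aS /=; apply/negP => aW.
  by have := BW a a aB aW; rewrite inE ball_center //= andbF.
move: (subseq_pairwise subB disK) (subseq_pairwise subB pK) pB => {BW szB subB}.
elim: B => //= a B IH /andP[/allP h1 p1] /andP[/allP h2 p2] /andP[/allP h3 p3].
rewrite {}IH // andbT; apply/allP => b bB.
move: (h1 b bB) (h2 b bB) (h3 b bB) => dab /adjacentP nab Nab.
have sU c : ball (S :|: W) i c \subset ball S i c by rewrite ball_anti ?subsetUl.
rewrite -setI_eq0; apply/eqP/setP => v; rewrite !inE negb_or.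
apply/negbTE/negP => /andP[].
(* A common vertex in one of the old balls contradicts disjointness or non-adjacency; in neither, it
   is a common outer neighbour, hence in [W], which has been deleted. *)
have [va|nva] := boolP (v \in ball S i a); have [vb|nvb] := boolP (v \in ball S i b).
- by rewrite (disjointFr dab va) in vb.
- move=> _ /orP[/(subsetP (sU b))|]; first exact/negP.
  move=> /andP[_ /existsP[u /andP[/(subsetP (sU b)) ub euv]]]; apply: nab.
  by exists v, u; rewrite edge_sym.
- move=> /orP[/(subsetP (sU a))|]; first by rewrite (negPf nva).
  move=> /andP[_ /existsP[u /andP[/(subsetP (sU a)) ub euv]]] _; apply: nab.
  by exists u, v.
move=> /orP[/(subsetP (sU a))|]; first by rewrite (negPf nva).
move=> /andP[/andP[vS vW] /existsP[u /andP[/(subsetP (sU a)) ua euv]]].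
move=> /orP[/(subsetP (sU b))|]; first by rewrite (negPf nvb).
move=> /andP[_ /existsP[w /andP[/(subsetP (sU b)) wb ewv]]].
have/subsetP/(_ v) := Nab; rewrite (negPf vW) => /implyP; apply/negP; rewrite negbK.
rewrite !inE vS nva nvb /=; apply/andP; split; apply/existsP.
  by exists u; rewrite ua.
by exists w; rewrite wb.
Qed.

(** Here [s] is the sum of the orders of the cliques excluded at depths 1 to [r], so it is chosen
    before [m]. *)
Lemma uniformly_quasi_wide (C : sgraph -> Prop) (r : nat) : nowhere_dense C ->
  exists s, forall m, exists n, forall G, C G -> forall A : seq G,
  uniq A -> n <= size A -> exists (S : {set G}) B,
  [/\ subseq B A, size B = m, #|S| <= s, all [pred a | a \notin S] B &
    pairwise (fun a b => [disjoint ball S r a & ball S r b]) B].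
Proof.
move=> nd; elim: r => [|r [s IH]].
  exists 0 => m; exists m => G _ A uA leA; exists set0, (take m A); split.
  - exact: take_subseq.
  - by rewrite size_takel.
  - by rewrite cards0.
  - by apply/allP => a _; rewrite /= inE.
  - have := take_uniq m uA; rewrite uniq_pairwise; apply: sub_pairwise.
    move=> a b /= ne; rewrite !setD0 disjoints1 inE; exact: ne.
have [t Ht] := nd r.+1; exists (s + t) => m.
have [n1 hn1] := quasi_wide_step r t m; have [n hn] := IH n1.
exists n => G CG A uA leA; have [S [B [subB szB szS BS pB]]] := hn G CG A uA leA.
have [|S' [B' [subB' szB' szS' BS' pB']]] :=
  hn1 G (Ht G CG) S B (subseq_uniq subB uA) _ BS pB; first by rewrite szB.
exists S', B'; split=> //; first exact: subseq_trans subB' subB.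
by apply: leq_trans szS' _; rewrite leq_add2r.
Qed.

(** * Cowitnesses in nowhere dense classes *)

Lemma card_bigcup_seq (T : finType) (I : Type) (s : seq I) (F : I -> {set T}) B :
  (forall i, #|F i| <= B) -> #|\bigcup_(i <- s) F i| <= size s * B.
Proof.
move=> leF; elim: s => [|i s IH]; first by rewrite big_nil cards0.
rewrite big_cons /= mulSn; apply: leq_trans (leq_card_setU _ _) _.
exact: leq_add.
Qed.

Lemma mem_bigcup_seq (T : finType) (I : eqType) (s : seq I) (F : I -> {set T}) x :
  (x \in \bigcup_(i <- s) F i) = has (fun i => x \in F i) s.
Proof.
by elim: s => [|i s IH]; rewrite ?big_nil ?inE // big_cons inE IH.
Qed.

Section Exploration.
Variables (G : sgraph) (k r : nat) (A : {set G}).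
Implicit Types (z : {set G} * G) (s : seq ({set G} * G)).

(** Only the vertex sets of the paths are recorded. The size bound is asked of all pairs, even those
    without a path, so that explored sets can be counted without side conditions. *)
Definition chosen_paths (P : {set G} * G -> {set G}) : Prop :=
  (forall z, #|P z| <= r.+1) /\
  (forall z, A \subset nbhd r z.1 -> z.2 \in A ->
    exists y p, [/\ y \in z.1, path_between y z.2 p, size p <= r & P z = [set:: y :: p]]).

Lemma chosen_paths_exist : exists P, chosen_paths P.
Proof.
have /fin_all_exists[P HP] : forall z, exists Q : {set G}, #|Q| <= r.+1 /\
    (A \subset nbhd r z.1 -> z.2 \in A ->
    exists y p, [/\ y \in z.1, path_between y z.2 p, size p <= r & Q = [set:: y :: p]]).
  move=> z; case: (boolP ((A \subset nbhd r z.1) && (z.2 \in A))); last first.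
    move=> h; exists set0; rewrite cards0; split=> // h1 h2.
    by rewrite h1 h2 in h.
  move=> /andP[/subsetP/(_ z.2) h zA]; move: (h zA); rewrite inE.
  move=> /existsP[y /andP[yz /dist_leP[p yp szp]]].
  exists [set:: y :: p]; split; last by move=> _ _; exists y, p.
  by rewrite cardsE; apply: leq_trans (card_size _) _.
by exists P; split=> z; case: (HP z).
Qed.

Variable P : {set G} * G -> {set G}.
Hypothesis HP : chosen_paths P.

(** Cross pairs are included in both orders: the separator argument fixes one [X] and follows its
    paths to all the [a]. *)
Definition explored s : {set G} :=
  \bigcup_(p <- s) \bigcup_(q <- s) P (p.1, q.2).

Definition candidate z : Prop :=
  [/\ z.1 \subset A, #|z.1| = k, A \subset nbhd r z.1 & z.2 \in A].

(* The most recent pair comes first. *)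
Fixpoint exploration s : Prop :=
  if s is z :: s' then
    [/\ candidate z, ~ captures r (explored s') z.1 z.2 & exploration s']
  else True.

Lemma explored_card s : #|explored s| <= size s * (size s * r.+1).
Proof.
apply: card_bigcup_seq => p; apply: card_bigcup_seq => q.
by case: HP => h _; exact: h.
Qed.

Lemma mem_explored s z z' v :
  z \in s -> z' \in s -> v \in P (z.1, z'.2) -> v \in explored s.
Proof.
move=> zs z's vP; rewrite mem_bigcup_seq; apply/hasP; exists z => //.
by rewrite mem_bigcup_seq; apply/hasP; exists z'.
Qed.

Lemma explored_sub s s' : {subset s <= s'} -> explored s \subset explored s'.
Proof.
move=> ss; apply/subsetP => v; rewrite mem_bigcup_seq => /hasP[z zs].
rewrite mem_bigcup_seq => /hasP[z' z's vP].
by apply: mem_explored vP; apply: ss.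
Qed.

Lemma captures_sub (Q Q' Y : {set G}) v :
  Q \subset Q' -> captures r Q Y v -> captures r Q' Y v.
Proof.
move=> /subsetP sQ [y [p [yY yp szp /hasP[q qp qQ]]]].
by exists y, p; split=> //; apply/hasP; exists q => //; exact: sQ.
Qed.

Lemma exploration_subseq s s' : subseq s s' -> exploration s' -> exploration s.
Proof.
elim: s' s => [|z' s' IH] [|z s] //= sub [cand ncap expl].
case: eqP sub => [->|_] sub; last exact: IH sub expl.
split=> //; last exact: IH sub expl.
move=> cap; apply: ncap; apply: captures_sub cap; apply: explored_sub.
exact: mem_subseq.
Qed.

Lemma cowitness_or_exploration N :
  (exists Q : {set G}, cowitness k r A Q /\ #|Q| <= N * (N * r.+1)) \/
  (exists2 s, size s = N & exploration s).
Proof.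
elim: N => [|N [[Q [cQ szQ]]|[s szs expl]]]; first by right; exists [::].
  by left; exists Q; split=> //; apply: leq_trans szQ _; rewrite leq_mul // leq_mul.
have [cQ|ncQ] := classic (cowitness k r A (explored s)).
  left; exists (explored s); split=> //; apply: leq_trans (explored_card s) _.
  by rewrite szs leq_mul // leq_mul.
right; apply: NNPP => none; apply: ncQ => X XA szX XD a aA.
apply: NNPP => ncap; apply: none; exists ((X, a) :: s); first by rewrite /= szs.
by split.
Qed.

Lemma exploration_candidate s z : exploration s -> z \in s -> candidate z.
Proof.
elim: s => //= z' s IH [cand _ expl]; rewrite in_cons => /predU1P[->//|].
exact: IH.
Qed.

Lemma candidate_path z z' : candidate z -> candidate z' ->
  exists y p, [/\ y \in z.1, path_between y z'.2 p, size p <= r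
    & P (z.1, z'.2) = [set:: y :: p]].
Proof.
by move=> [_ _ zD _] [_ _ _ z'A]; case: HP => _ /(_ (z.1, z'.2) zD z'A).
Qed.

(** A repeated [a] is the end of an explored path, so it captures its new pair as the end of any
    short path to it. *)
Lemma exploration_uniq s : exploration s -> uniq (map snd s).
Proof.
elim: s => //= z s IH [cand ncap expl]; rewrite IH // andbT.
apply/negP => /mapP[z' z's e]; apply: ncap.
have [y [p [yX yp szp _]]] := candidate_path cand cand.
have cand' := exploration_candidate expl z's.
have [y' [p' [_ /andP[_ /eqP lp'] _ eP]]] := candidate_path cand' cand'.
exists y, p; split=> //; apply/hasP; exists z.2.
  by have /andP[_ /eqP <-] := yp; exact: mem_last.
by apply: (mem_explored z's z's); rewrite eP inE e -lp'; exact: mem_last.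
Qed.

Lemma path_between_split (y v q : G) p : path_between y v p -> q \in y :: p ->
  exists p1 p2, [/\ path_between y q p1, path_between q v p2
                  & size p = size p1 + size p2].
Proof.
move=> + qp; case/splitPl: qp => p1 p2 lp1.
rewrite /path_between cat_path last_cat lp1 => /andP[/andP[h1 h2] h3].
by exists p1, p2; rewrite h1 h2 h3 lp1 eqxx size_cat.
Qed.

Lemma path_between_cat (y v q : G) p1 p2 :
  path_between y q p1 -> path_between q v p2 -> path_between y v (p1 ++ p2).
Proof.
rewrite /path_between cat_path last_cat => /andP[-> /eqP->] /andP[-> ->].
by [].
Qed.

(* The truncated distances of X and of a to the vertices of S, read off from
   the predicates dist_le d for d <= r. *)
Definition profile (s0 : nat) (g : G) (S : {set G}) z :
    {ffun 'I_s0 -> {ffun 'I_r.+1 -> bool * bool}} :=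
  [ffun i : 'I_s0 => [ffun d : 'I_r.+1 =>
    ([exists x in z.1, dist_le d x (nth g (enum S) i)],
     dist_le d (nth g (enum S) i) z.2)]].

(** Cut the path at [q]. Equal profiles turn the first piece into one from [z0.1] and the second
    into one to [z0.2], no longer than before. Their concatenation may repeat vertices. *)
Lemma profile_captures (s0 : nat) g (S Q : {set G}) z0 z1 z2 y p q :
  #|S| <= s0 -> profile s0 g S z1 = profile s0 g S z0 ->
  profile s0 g S z2 = profile s0 g S z0 ->
  y \in z1.1 -> path_between y z2.2 p -> size p <= r -> q \in y :: p ->
  q \in S -> q \in Q -> captures r Q z0.1 z0.2.
Proof.
move=> szS e1 e2 yz1 yp szp qp qS qQ.
have [p1 [p2 [yp1 p2z sz12]]] := path_between_split yp qp.
have lt1 : size p1 < r.+1 by lia.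
have lt2 : size p2 < r.+1 by lia.
have ltq : index q (enum S) < s0.
  by apply: leq_trans szS; rewrite cardE index_mem mem_enum.
have enq : nth g (enum S) (index q (enum S)) = q by rewrite nth_index ?mem_enum.
move: e1 => /ffunP/(_ (Ordinal ltq)); rewrite !ffunE => /ffunP/(_ (Ordinal lt1)).
rewrite !ffunE /= enq => -[h1 _].
move: e2 => /ffunP/(_ (Ordinal ltq)); rewrite !ffunE => /ffunP/(_ (Ordinal lt2)).
rewrite !ffunE /= enq => -[_ h2].
have /existsP[x /andP[xz0 /dist_leP[p1' xp1' sz1']]] :
    [exists x in z0.1, dist_le (size p1) x q].
  by rewrite -h1; apply/existsP; exists y; rewrite yz1; apply/dist_leP; exists p1.
have /dist_leP[p2' qp2' sz2'] : dist_le (size p2) q z0.2.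
  by rewrite -h2; apply/dist_leP; exists p2.
exists x, (p1' ++ p2'); split=> //.
- exact: path_between_cat xp1' qp2'.
- by rewrite size_cat; lia.
apply/hasP; exists q => //; have /andP[_ /eqP <-] := xp1'.
by rewrite -cat_cons mem_cat mem_last.
Qed.

(** Otherwise every [a] in the list has some vertex of the fixed [X] in its ball. As [X] has only
    [k] vertices, two of these balls share one. *)
Lemma exploration_meets_separator (S : {set G}) s z :
  exploration s -> k < size s -> z \in s ->
  pairwise (fun a b => [disjoint ball S r a & ball S r b]) (map snd s) ->
  exists2 z', z' \in s & exists y p q, [/\ y \in z.1, path_between y z'.2 p,
    size p <= r, q \in y :: p & (q \in S) && (q \in explored s)].
Proof.
move=> expl szs zs pws; apply: NNPP => none.
have cz := exploration_candidate expl zs.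
have [z'||y yz] := @pigeonhole _ _ (fun z' y => y \in ball S r z'.2) (enum z.1) s 1.
- move=> z's; have cz' := exploration_candidate expl z's.
  have [y [p [yz yp szp eP]]] := candidate_path cz cz'.
  apply/hasP; exists y; rewrite ?mem_enum //.
  apply/reach_ball/reach_sym; have /andP[pp /eqP lp] := yp; exists p; split=> //.
  apply/allP => q qp; rewrite /= in_setC; apply/negP => qS; apply: none.
  exists z' => //; exists y, p, q; split=> //; rewrite qS.
  by apply: mem_explored zs z's _; rewrite eP inE.
- by rewrite -cardE muln1; case: cz => _ ->.
rewrite -size_filter.
have := subseq_pairwise (map_subseq snd (filter_subseq (fun z' => y \in ball S r z'.2) s)) pws.
have := filter_all (fun z' => y \in ball S r z'.2) s.
case: filter => [|z1 [|z2 s']] //= /and3P[y1 y2 _] /andP[/andP[d12 _] _] _.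
by rewrite (disjointFr d12 y1) in y2.
Qed.

End Exploration.

Lemma nowhere_dense_bounded_cowitnesses (C : sgraph -> Prop) :
  nowhere_dense C -> bounded_cowitnesses C.
Proof.
move=> nd r k; have [s0 hs0] := uniformly_quasi_wide r nd.
pose F := {ffun 'I_s0 -> {ffun 'I_r.+1 -> bool * bool}}.
(* Some profile then occurs more than [k.+1] times: on one newest pair and on more than [k] older
   ones. *)
have [n hn] := hs0 (#|F| * k.+1).+1.
exists (n * (n * r.+1)) => G CG A.
have [P HP] := chosen_paths_exist r A.
have [//|[s szs expl]] := cowitness_or_exploration k HP n; exfalso.
have [|S [B [subB szB szS BS pB]]] := hn G CG _ (exploration_uniq HP expl).
  by rewrite size_map szs.
have [mk _ eB] := subseqP subB; rewrite -map_mask in eB.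
have expl2 := exploration_subseq (mask_subseq mk s) expl.
move: (mask mk s) expl2 eB => s2 expl2 eB {s szs expl subB mk}.
have sz2 : size s2 = (#|F| * k.+1).+1 by rewrite -szB eB size_map.
have [z2 _] : exists z, z \in s2.
  by case: (s2) sz2 => // z ? _; exists z; rewrite mem_head.
pose pr := profile r s0 z2.2 S.
have [z||y _] := @pigeonhole _ _ (fun z y => pr z == y) (enum F) s2 k.+1.
- by move=> _; apply/hasP; exists (pr z); rewrite ?mem_enum.
- by rewrite -cardE sz2.
rewrite -size_filter.
have := filter_all (fun z => pr z == y) s2.
have := exploration_subseq (filter_subseq (fun z => pr z == y) s2) expl2.
have := subseq_pairwise (map_subseq snd (filter_subseq (fun z => pr z == y) s2)).
rewrite -eB => /(_ _ pB).
(* [z0] is the newest pair of its class. The path found below joins older pairs, so the vertex where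
   it meets [S] was explored before [z0] was added. *)
case: filter => // z0 [|z1 s] //= pw [_ ncap expl] /andP[e0 e1] lts.
have /allP es : all (fun z => pr z == y) (z1 :: s) by [].
have [|||z' z's [x [p [q [xz1 xp szp qp /andP[qS qQ]]]]]] :=
  exploration_meets_separator (S := S) (s := z1 :: s) (z := z1) HP expl.
- by rewrite /=; lia.
- exact: mem_head.
- by case/andP: pw.
apply: ncap; apply: (profile_captures (g := z2.2)) szS _ _ xz1 xp szp qp qS qQ.
  by rewrite -/(pr z1) (eqP (es z1 (mem_head _ _))) -(eqP e0).
by rewrite -/(pr z') (eqP (es z' z's)) -(eqP e0).
Qed.

(** * Subdivided cliques have no small cowitness *)

(* H is the clique on pr 0, ..., pr (n-1) with every edge replaced by a path of
   length l; for i < j, pt i j s is the point at distance s from pr i on the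
   path from pr i to pr j. *)
Record subdivided_clique (H : sgraph) (n l : nat) (pr : 'I_n -> H)
    (pt : 'I_n -> 'I_n -> nat -> H) : Prop := SubdividedClique {
  pt0 : forall i j : 'I_n, i < j -> pt i j 0 = pr i;
  ptl : forall i j : 'I_n, i < j -> pt i j l = pr j;
  pr_inj : injective pr;
  pt_inj : forall (i j i' j' : 'I_n) s s', i < j -> i' < j' -> 0 < s < l ->
    s' <= l -> pt i j s = pt i' j' s' -> [/\ i = i', j = j' & s = s'];
  pt_cover : forall v, exists (i j : 'I_n) s, [/\ i < j, s <= l & v = pt i j s];
  pt_edge : forall (i j : 'I_n) s, i < j -> s < l ->
    edge (pt i j s) (pt i j s.+1);
  pt_edgeP : forall u v, edge u v -> exists (i j : 'I_n) s, [/\ i < j, s < l &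
    (u = pt i j s /\ v = pt i j s.+1) \/ (v = pt i j s /\ u = pt i j s.+1)] }.

Lemma reach_dist_le (G : sgraph) d (x y : G) : reach [set: G] d x y -> dist_le d x y.
Proof.
move=> [p [xp lp szp _]]; apply/dist_leP; exists p => //.
by rewrite /path_between xp lp eqxx.
Qed.

Section SubdividedClique.
Variables (H : sgraph) (n l : nat) (pr : 'I_n -> H).
Variable (pt : 'I_n -> 'I_n -> nat -> H).
Hypotheses (SC : subdivided_clique l pr pt) (l_gt0 : 0 < l).

Let m := l./2.

Let m_bounds : m.*2 <= l <= m.*2.+1.
Proof. by rewrite /m; have := odd_double_half l; case: odd; lia. Qed.

Definition is_end (i j : 'I_n) (s : nat) (k : 'I_n) : Prop :=
  (s = 0 /\ k = i) \/ (s = l /\ k = j).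

Lemma pt_end (i j : 'I_n) s : i < j -> s <= l ->
  (0 < s < l) \/ exists2 k, is_end i j s k & pt i j s = pr k.
Proof.
move=> ltij les; have [->|s_gt0] := posnP s.
  by right; exists i; [left | rewrite (pt0 SC)].
have [->|nsl] := eqVneq s l; last by left; lia.
by right; exists j; [right | rewrite (ptl SC)].
Qed.

(** Coordinates determine a point except at branch vertices, which end several paths. *)
Lemma pt_eq (i j i' j' : 'I_n) s s' : i < j -> i' < j' -> s <= l -> s' <= l ->
  pt i j s = pt i' j' s' ->
  [/\ i = i', j = j' & s = s'] \/ exists2 k, is_end i j s k & is_end i' j' s' k.
Proof.
move=> ltij ltij' les les' e.
case: (pt_end ltij les) => [hs|[k ek hk]]; first by left; exact: (pt_inj SC) e.
case: (pt_end ltij' les') => [hs|[k' ek' hk']].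
  by left; case: (pt_inj SC ltij' ltij hs les (esym e)).
by right; exists k => //; rewrite (pr_inj SC (etrans (etrans (esym hk) e) hk')).
Qed.

Lemma pt_reach (i j : 'I_n) s s' : i < j -> s <= s' <= l ->
  reach [set: H] (s' - s) (pt i j s) (pt i j s').
Proof.
move=> ltij; elim: s' => [|s' IH] /andP[les les'].
  by move: les; rewrite leqn0 => /eqP->; apply: reach_refl; rewrite inE.
move: les; rewrite leq_eqVlt => /predU1P[->|les].
  by apply: reach_refl; rewrite inE.
rewrite subSn // -addn1; apply: reach_trans (IH _) _; first by lia.
by apply: reach_edge; rewrite ?inE // (pt_edge SC).
Qed.

Lemma pr_reach (i j : 'I_n) : reach [set: H] l (pr i) (pr j).
Proof.
have lt_reach (a b : 'I_n) : a < b -> reach [set: H] l (pr a) (pr b).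
  move=> lt; have := @pt_reach _ _ 0 l lt; rewrite subn0 (pt0 SC lt) (ptl SC lt).
  by apply; rewrite leqnn.
have [lt|lt|/val_inj->] := ltngtP i j; first exact: lt_reach.
  exact/reach_sym/lt_reach.
by apply: reach_refl; rewrite inE.
Qed.

(** The nearer end of the path through [v] is within [m] of [v], and any two branch vertices are
    within [l]. *)
Lemma pr_dist_le (i : 'I_n) (v : H) : dist_le (l + m) (pr i) v.
Proof.
have [j [k [s [ltjk les ->]]]] := pt_cover SC v; apply: reach_dist_le.
have [lesm|ltms] := leqP s m.
  apply: reach_trans (pr_reach i j) _; apply: (reachW (subxx _) lesm).
  by have := @pt_reach _ _ 0 s ltjk; rewrite subn0 (pt0 SC ltjk); apply.
apply: reach_trans (pr_reach i k) _; apply: reach_sym.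
apply: (@reachW _ _ _ (l - s) _ _ _ (subxx _)); first by lia.
by rewrite -(ptl SC ltjk); apply: pt_reach => //; rewrite les /=.
Qed.

Section Potential.
Variable q : nat.
Variables x y z : 'I_n.
Hypotheses (ex : x = 3 * q :> nat) (ey : y = 3 * q + 1 :> nat) (ez : z = 3 * q + 2 :> nat).

Let ltyz : y < z. Proof. lia. Qed.

(* Distance from pr i to the middle pt y z m of the path from y to z. *)
Let w (i : 'I_n) : nat := if i == y then m else if i == z then l - m else l + m.

(** Distance to the middle in coordinates: along the path that contains it, and otherwise through
    the better of the two ends. *)
Let F (i j : 'I_n) (s : nat) : nat :=
  if (i == y) && (j == z) then (s - m) + (m - s)
  else minn (w i + s) (w j + (l - s)).

Definition triangle : {set H} :=
  [set v | [exists i : 'I_n, exists j : 'I_n, exists s : 'I_l.+1,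
     [&& i < j, i %/ 3 == q, j %/ 3 == q & v == pt i j s]]].

Lemma triangleP v : reflect (exists (i j : 'I_n) s,
    [/\ i < j, s <= l, i %/ 3 = q, j %/ 3 = q & v = pt i j s]) (v \in triangle).
Proof.
rewrite inE; apply: (iffP existsP).
  move=> [i /existsP[j /existsP[s /and4P[lt /eqP iq /eqP jq /eqP e]]]].
  by exists i, j, s; split=> //; rewrite -ltnS.
move=> [i [j [s [lt les iq jq e]]]]; exists i; apply/existsP; exists j.
apply/existsP; exists (Ordinal (les : s < l.+1)).
by rewrite lt iq jq e !eqxx.
Qed.

Let w_bounds i : m <= w i <= l + m.
Proof. by rewrite /w; case: eqP => _; [lia|]; case: eqP => _; lia. Qed.

Let w_out (i : 'I_n) : i %/ 3 != q -> w i = l + m.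
Proof.
move=> ni; rewrite /w; case: eqP => [e|_]; first by rewrite e ey in ni; lia.
by case: eqP => [e|//]; rewrite e ez in ni; lia.
Qed.

Let F_end (i j : 'I_n) s k : i < j -> is_end i j s k -> F i j s = w k.
Proof.
move=> ltij; have := w_bounds i; have := w_bounds j.
rewrite /F => hj hi [[-> ->]|[-> ->]].
  by case: andP => [[/eqP-> _]|_]; [rewrite /w eqxx; lia | lia].
case: andP => [[/eqP ei /eqP->]|_]; last by lia.
by rewrite /w eqxx; case: eqP => [e|_]; [move: ltyz; rewrite e ltnn | lia].
Qed.

(** The coordinates are picked arbitrarily; by [F_end] all coordinates of a branch vertex give the
    same value. *)
Let phi (v : H) : nat :=
  if [pick c : 'I_n * 'I_n * 'I_l.+1 | (c.1.1 < c.1.2) && (v == pt c.1.1 c.1.2 c.2)]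
  is Some c then F c.1.1 c.1.2 c.2 else 0.

Let phi_pt (i j : 'I_n) s : i < j -> s <= l -> phi (pt i j s) = F i j s.
Proof.
move=> ltij les; rewrite /phi; case: pickP => [[[i' j'] s'] /=|]; last first.
  by move=> /(_ (i, j, Ordinal (les : s < l.+1))); rewrite /= ltij eqxx.
move=> /andP[ltij' /eqP e].
case: (pt_eq ltij ltij' les _ e) => [|[-> -> ->]//|[k e1 e2]].
  by rewrite -ltnS.
by rewrite (F_end ltij e1) (F_end ltij' e2).
Qed.

Let phi_edge u v : edge u v -> phi u <= (phi v).+1.
Proof.
move=> /(pt_edgeP SC)[i [j [s [ltij lts []]]]] [-> ->];
  rewrite !phi_pt // ?(ltnW lts) // /F; case: ifP => _; lia.
Qed.

(** The triangle can be left only from one of its branch vertices towards an outside one. There [w]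
    has its largest value [l + m], so the first step out does not lower [phi]. *)
Let triangle_descent u v :
  edge u v -> u \in triangle -> phi v < phi u -> v \in triangle.
Proof.
move=> /(pt_edgeP SC)[i [j [s [ltij lts euv]]]] uT ltphi.
have [/andP[/eqP iq /eqP jq]|nT] := boolP ((i %/ 3 == q) && (j %/ 3 == q)).
  by apply/triangleP; case: euv => -[e1 e2];
    [exists i, j, s.+1 | exists i, j, s; split=> //; exact: ltnW].
exfalso.
have key su : su <= l -> u = pt i j su ->
    (su = 0 /\ j %/ 3 != q) \/ (su = l /\ i %/ 3 != q).
  move=> les eu; have /triangleP[i' [j' [s' [lt' les' iq jq eu']]]] := uT.
  rewrite eu in eu'.
  case: (pt_eq ltij lt' les les' eu') => [[ei ej _]|[k e1 e2]].
    by rewrite ei ej iq jq eqxx in nT.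
  have kq : k %/ 3 = q by case: e2 => -[_ ->].
  case: e1 => -[-> ek]; [left|right]; split=> //; move: nT; rewrite -ek kq eqxx //.
  by rewrite andbT.
have Fne : i %/ 3 != q \/ j %/ 3 != q -> forall s',
    F i j s' = minn (w i + s') (w j + (l - s')).
  rewrite /F; case: andP => [[/eqP-> /eqP->]|//]; lia.
have := w_bounds i; have := w_bounds j => hj hi.
case: euv => [[eu ev]|[ev eu]].
- have [||[e0 nj]|[el _]] := key s => //; [exact: ltnW| |lia].
  move: ltphi; rewrite eu ev !phi_pt // ?(ltnW lts) // !Fne; try by right.
  by rewrite e0 (w_out nj); lia.
- have [||[//]|[el ni]] := key s.+1 => //.
  move: ltphi; rewrite eu ev !phi_pt // ?(ltnW lts) // !Fne; try by left.
  by rewrite (w_out ni); lia.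
Qed.

Let phi_path u p : path (@edge H) u p -> phi u <= size p + phi (last u p).
Proof.
elim: p u => //= v p IH u /andP[euv /IH]; have := phi_edge euv; lia.
Qed.

(** As [phi] drops by at most one per edge, a walk this short must descend at every step. *)
Lemma triangle_path u p : path (@edge H) u p -> phi (last u p) = 0 ->
  size p <= phi u -> u \in triangle -> all (mem triangle) (u :: p).
Proof.
elim: p u => [|v p IH] u /=; first by move=> _ _ _ ->.
move=> /andP[euv vp] e0 szp uT; have := phi_path vp; rewrite e0 addn0 => lev.
have ltv : phi v < phi u by lia.
rewrite uT /=; apply: IH => //; first by have := phi_edge euv; lia.
exact: triangle_descent ltv.
Qed.

Lemma triangle_capture (Q : {set H}) :
  captures (l + m) Q [set pr x] (pt y z m) -> exists2 v, v \in Q & v \in triangle.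
Proof.
move=> [u [p [/set1P-> /andP[pp /eqP lp] szp /hasP[v vp vQ]]]].
exists v => //; have ltxy : x < y by lia.
have phix : phi (pr x) = l + m.
  rewrite -(pt0 SC ltxy) phi_pt // (@F_end _ _ _ x) //; last by left.
  by rewrite /w; case: eqP => [e|_]; [|case: eqP => [e|//]]; move: ex; rewrite e; lia.
have xT : pr x \in triangle.
  by apply/triangleP; exists x, y, 0; split; rewrite ?(pt0 SC) //; lia.
have a0 : phi (last (pr x) p) = 0.
  by rewrite lp phi_pt ?/F ?eqxx ?subnn //; lia.
by have /allP := triangle_path pp a0 (leq_trans szp (eq_leq (esym phix))) xT; apply.
Qed.

End Potential.

(** Only branch vertices lie on several paths, and an index belongs to one block of three. *)
Lemma triangle_inj q q' v : v \in triangle q -> v \in triangle q' -> q = q'.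
Proof.
move=> /triangleP[i [j [s [lt les iq jq ->]]]].
move=> /triangleP[i' [j' [s' [lt' les' iq' jq' e]]]].
case: (pt_eq lt lt' les les' e) => [[ei _ _]|[k e1 e2]]; first by rewrite -iq -iq' ei.
have <- : k %/ 3 = q by case: e1 => -[_ ->].
by case: e2 => -[_ ->].
Qed.

Lemma subdivided_clique_cowitness (c : nat) (Q : {set H}) :
  n = 3 * c.+1 -> cowitness 1 (l + l./2) [set: H] Q -> c < #|Q|.
Proof.
move=> en cow.
have /fin_all_exists[f Hf] : forall q : 'I_c.+1, exists v,
    (v \in Q) && (v \in triangle q).
  move=> q; have ltq := ltn_ord q.
  have ltx : 3 * q < n by rewrite en; lia.
  have lty : 3 * q + 1 < n by rewrite en; lia.
  have ltz : 3 * q + 2 < n by rewrite en; lia.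
  have cap := cow [set pr (Ordinal ltx)] (subsetT _) (cards1 _) _
    (pt (Ordinal lty) (Ordinal ltz) m) (in_setT _).
  case: (@triangle_capture q (Ordinal ltx) (Ordinal lty) (Ordinal ltz) _ _ _ Q) => //.
    apply: cap; apply/subsetP => v _; rewrite inE; apply/existsP.
    by exists (pr (Ordinal ltx)); rewrite inE eqxx pr_dist_le.
  by move=> v vQ vT; exists v; rewrite vQ.
have injf : injective f.
  move=> q q' e; apply: val_inj; apply: (@triangle_inj _ _ (f q)).
    by case/andP: (Hf q).
  by rewrite e; case/andP: (Hf q').
have <- : #|f @: [set: 'I_c.+1]| = c.+1 by rewrite card_imset // cardsT card_ord.
apply: subset_leq_card; apply/subsetP => v /imsetP[q _ ->].
by case/andP: (Hf q).
Qed.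

End SubdividedClique.

(** * From shallow clique minors to exact subdivisions *)

(** [q] omits both ends: [c] is common to all legs, and [z] will lie in a different branch set,
    outside [U]. *)
Definition leg (T : eqType) (e : rel T) (U : pred T) (d : nat) (c z : T)
    (q : seq T) : bool :=
  [&& path e c (rcons q z), uniq (c :: q), size q <= d & all U q].

(* Among many legs from c, either many are pairwise disjoint, or many meet a
   fixed leg, hence pass through a common vertex, from which they are shorter. *)
Lemma spider (d n : nat) : exists N, forall (T I : eqType) (e : rel T)
  (U : pred T) (z : I -> T) (A : seq I) (c : T) (q : I -> seq T),
  N <= size A -> U c -> (forall v, v \in A -> leg e U d c (z v) (q v)) ->
  exists y (q' : I -> seq T) B, [/\ U y, subseq B A, size B = n,
    forall v, v \in B -> leg e U d y (z v) (q' v) &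
    pairwise (fun v w => ~~ has (mem (q' v)) (q' w)) B].
Proof.
elim: d => [|d [N0 IH]].
  exists n => T I e U z A c q leA Uc legs; exists c, q, (take n A); split=> //.
  - exact: take_subseq.
  - by rewrite size_takel.
  - by move=> v /mem_take; exact: legs.
  - have q0 v : v \in take n A -> q v = [::].
      move=> /mem_take /legs /and4P[_ _ + _].
      by rewrite leqn0 size_eq0 => /eqP.
    elim: (take n A) q0 => //= v B IHB q0; rewrite IHB ?andbT; last first.
      by move=> w wB; apply: q0; rewrite in_cons wB orbT.
    by apply/allP => w wB; rewrite (q0 w) // in_cons wB orbT.
(* One leg [v0] and [(d.+1 * N0).+1] others meeting it: more than [N0] of these pass through the
   same vertex of [v0]. *)
have [N hN] := ramsey n (d.+1 * N0).+2.
exists N => T I e U z A c q leA Uc legs.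
have [[B [subB szB pB]]|[[|v0 K] [subK szK pK]]] :=
    hN I (fun v w => ~~ has (mem (q v)) (q w)) A leA.
- exists c, q, B; split=> //.
  by move=> v /(mem_subseq subB); exact: legs.
- by [].
move: szK pK => /= [szK] /andP[/allP meet _].
have v0A : v0 \in A by apply: (mem_subseq subK); rewrite mem_head.
have subKA : subseq K A := subseq_trans (subseq_cons _ _) subK.
have /and4P[_ _ szv0 Uv0] := legs v0 v0A.
have [v||y yq] := @pigeonhole _ _ (fun v y => y \in q v) (q v0) K N0.
- move=> /meet; rewrite negbK => /hasP[y yv yv0].
  by apply/hasP; exists y.
- by rewrite szK ltnS leq_mul2r szv0 orbT.
rewrite -size_filter => ltN.
set K' := filter _ K in ltN.
pose q2 v := drop (index y (q v)).+1 (q v).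
have legs2 v : v \in K' -> leg e U d y (z v) (q2 v).
  rewrite mem_filter => /andP[yv /(mem_subseq subKA) /legs].
  rewrite /leg /q2; case/path.splitP: yv => p1 p2.
  rewrite rcons_cat cat_path last_rcons -cat_cons cat_uniq size_cat size_rcons all_cat.
  rewrite [uniq (y :: _)]/= => /and4P[/andP[_ ->] /and3P[_ hp2 ->] lesz /andP[_ ->]].
  rewrite /= !andbT; apply/andP; split; last by lia.
  by apply: contra hp2 => yp2; apply/hasP; exists y; rewrite //= in_cons mem_rcons mem_head orbT.
have [y' [q' [B [Uy' subB szB legB pB]]]] :=
  IH T I e U z K' y q2 (ltnW ltN) (allP Uv0 y yq) legs2.
exists y', q', B; split=> //.
  exact: subseq_trans subB (subseq_trans (filter_subseq _ _) subKA).
by move=> v /legB /and4P[h1 h2 h3 h4]; rewrite /leg h1 h2 h4 (leq_trans h3).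
Qed.

Lemma reach_uniq (G : sgraph) (U : {set G}) d x y : reach U d x y ->
  exists p, [/\ path (@edge G) x p, last x p = y, size p <= d,
                all (mem U) p & uniq (x :: p)].
Proof.
move=> [p [xp <- szp /andP[_ /allP pU]]].
case: (shortenP xp) => p' xp' up' sub; exists p'; split=> //.
  by apply: leq_trans szp; apply: uniq_leq_size sub; case/andP: up'.
by apply/allP => v /sub /pU.
Qed.

Lemma branch_spiders (r M : nat) : exists N, forall (G : sgraph) (t : nat)
  (U : 'I_t -> {set G}) (c : 'I_t -> G) (a : 'I_t), N < t ->
  (forall v, v \in U a -> reach (U a) r (c a) v) -> c a \in U a ->
  (forall b, a != b -> exists u v, [/\ u \in U a, v \in U b & edge u v]) ->
  exists y (q : 'I_t -> seq G) B, [/\ y \in U a, uniq B & size B = M] /\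
    [/\ a \notin B,
    forall b, b \in B -> exists2 z, z \in U b & leg (@edge G) (mem (U a)) r y z (q b) &
    pairwise (fun v w => ~~ has (mem (q v)) (q w)) B].
Proof.
have [N hN] := spider r M; exists N => G t U c a ltN reachU ca adj.
have /fin_all_exists[zq Hzq] : forall b, exists zq : G * seq G, a != b ->
    zq.1 \in U b /\ leg (@edge G) (mem (U a)) r (c a) zq.1 zq.2.
  move=> b; have [eab|nab] := eqVneq a b; first by exists (c a, [::]).
  have [u [v [uU vU euv]]] := adj b nab.
  have [p [cp lp szp pU up]] := reach_uniq (reachU u uU).
  exists (v, p) => _; split=> //.
  by rewrite /leg rcons_path cp lp euv up szp pU.
pose A := enum (predC1 a).
have uA : uniq A by exact: enum_uniq.
have nA b : b \in A -> a != b by rewrite mem_enum eq_sym.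
have szA : N <= size A by rewrite -cardE cardC1 card_ord; lia.
have [|v /nA /Hzq[]//|y [q [B [Uy subB szB legB pB]]]] :=
    hN _ _ (@edge G) (mem (U a)) (fun b => (zq b).1) A (c a) (fun b => (zq b).2) szA.
- exact: ca.
exists y, q, B; split; split=> //.
- exact: subseq_uniq subB uA.
- by apply/negP => /(mem_subseq subB) /nA; rewrite eqxx.
move=> b bB; exists (zq b).1; last exact: legB.
by have /Hzq[] := nA b (mem_subseq subB bB).
Qed.

(** The first [n] branch sets supply the principal vertices. Each ordered pair [(i, j)] gets a
    private branch set [w (i, j)], reached by a leg from [y i]; the path from [y i] to [y j] runs
    through [w (i, j)] and [w (j, i)]. Each half costs [r.+1] for the leg and [r + r] inside the
    branch set, and one edge joins the halves. *)
Lemma topological_clique (r n : nat) : exists t, forall G : sgraph,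
  shallow_minor r (complete t) G ->
  exists (y : 'I_n -> G) (q : 'I_n -> 'I_n -> seq G), [/\ injective y,
    forall i j, i != j -> [/\ path (@edge G) (y i) (rcons (q i j) (y j)),
      uniq (q i j) & size (q i j) < 6 * r + 3],
    forall i j k, i != j -> y k \notin q i j &
    forall i j i' j' v, i != j -> i' != j' -> v \in q i j -> v \in q i' j' ->
      (i = i' /\ j = j') \/ (i = j' /\ j = i')].
Proof.
(* The [n] principal branch sets must be avoided and [n * n] representatives remain to be found. *)
have [N hN] := branch_spiders r (n + n * n).
exists (n + N.+1) => G /sets_of_shallow_minor[U [c [disU cU reachU adjU]]].
set t := n + N.+1 in U c disU cU reachU adjU *.
have ltN : N < t by rewrite /t; lia.
have disP a b v : v \in U a -> v \in U b -> a = b.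
  move=> va vb; apply/eqP; apply: contraLR vb => /disU dab.
  by rewrite (disjointFr dab va).
have /fin_all_exists[YQ HYQ] : forall a, exists YQ : G * ('I_t -> seq G) * seq 'I_t,
    [/\ YQ.1.1 \in U a, uniq YQ.2 & size YQ.2 = n + n * n] /\
    [/\ a \notin YQ.2, forall b, b \in YQ.2 -> exists2 z, z \in U b &
          leg (@edge G) (mem (U a)) r YQ.1.1 z (YQ.1.2 b) &
        pairwise (fun v w => ~~ has (mem (YQ.1.2 v)) (YQ.1.2 w)) YQ.2].
  move=> a; have [y [q [B h]]] := hN G t U c a ltN (reachU a) (cU a) (adjU a).
  by exists (y, q, B).
pose u (i : 'I_n) : 'I_t := lshift N.+1 i.
have uinj : injective u by exact: lshift_inj.
have [w winj Hw] : exists2 w : 'I_n * 'I_n -> 'I_t, injective w &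
    forall ij, w ij \in [set:: (YQ (u ij.1)).2] :\: [set u k | k : 'I_n].
  apply: distinct_representatives => ij; rewrite card_prod card_ord cardsD.
  have [[_ uB szB] _] := HYQ (u ij.1).
  have -> : #|[set:: (YQ (u ij.1)).2]| = n + n * n.
    by rewrite cardsE (card_uniqP uB).
  have : #|[set:: (YQ (u ij.1)).2] :&: [set u k | k : 'I_n]| <= n.
    apply: leq_trans (subset_leq_card (subsetIr _ _)) _.
    by rewrite card_imset // card_ord.
  by move=> h; rewrite addnC -addnBA // leq_addr.
have wB i j : w (i, j) \in (YQ (u i)).2 by have := Hw (i, j); rewrite !inE => /andP[].
have wu i j k : w (i, j) <> u k.
  by move=> e; have := Hw (i, j); rewrite e inE imset_f.
pose y i := (YQ (u i)).1.1; pose q0 i j := (YQ (u i)).1.2 (w (i, j)).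
have yU i : y i \in U (u i) by have [[]] := HYQ (u i).
have yinj : injective y.
  by move=> i j e; apply/uinj/(disP _ _ (y i)); rewrite // e.
have leg0 i j : exists2 z, z \in U (w (i, j)) &
    leg (@edge G) (mem (U (u i))) r (y i) z (q0 i j).
  by have [_ [_ h _]] := HYQ (u i); exact: h (wB i j).
have q0U i j v : v \in q0 i j -> v \in U (u i).
  by have [z _ /and4P[_ _ _ /allP h]] := leg0 i j; move/h.
have q0y i j : y i \notin q0 i j by have [z _ /and4P[_ /andP[]]] := leg0 i j.
have q0dis i j j' v : v \in q0 i j -> v \in q0 i j' -> j = j'.
  move=> vj vj'; apply/eqP; apply: contraT => njj'.
  have [_ [_ _ pw]] := HYQ (u i).
  have symq : symmetric (fun b b' => ~~ has (mem ((YQ (u i)).1.2 b)) ((YQ (u i)).1.2 b')).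
    by move=> b b'; rewrite has_sym.
  have := pairwise_sym_in symq pw (wB i j) (wB i j').
  rewrite (inj_eq winj) xpair_eqE eqxx => /(_ njj') /hasPn /(_ v vj').
  by rewrite /= vj.
(* The territory of [(i, j)]. Territories are disjoint and contain no principal vertex, so any paths
   inside them meet only as allowed. *)
pose H i j := [set:: q0 i j] :|: U (w (i, j)).
have Hdis i j i' j' v : v \in H i j -> v \in H i' j' -> i = i' /\ j = j'.
  rewrite !inE => /orP[h|h] /orP[h'|h'].
  - have eii : i = i' := uinj _ _ (disP _ _ _ (q0U _ _ _ h) (q0U _ _ _ h')).
    by rewrite -eii in h' *; split=> //; exact: q0dis h h'.
  - by case: (@wu i' j' i); apply: disP h' (q0U _ _ _ h).
  - by case: (@wu i j i'); apply: disP h (q0U _ _ _ h').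
  - by have [-> ->] := winj _ _ (disP _ _ _ h h').
have Hy i j k : y k \notin H i j.
  rewrite !inE negb_or; apply/andP; split; apply/negP => h; last first.
    by apply: (@wu i j k); apply: disP h (yU k).
  have e := uinj _ _ (disP _ _ _ (yU k) (q0U _ _ _ h)).
  by rewrite e (negPf (q0y _ _)) in h.
have reachH i j v : v \in U (w (i, j)) -> reach (y i |: H i j) (3 * r + 1) (y i) v.
  move=> vU; have [z zU /and4P[pz _ szq qU]] := leg0 i j.
  have -> : 3 * r + 1 = r.+1 + (r + r) by lia.
  apply: (reach_trans (y := z)).
    exists (rcons (q0 i j) z); split; rewrite ?last_rcons ?size_rcons //.
    apply/allP => x; rewrite in_cons mem_rcons in_cons !inE.
    by case/or3P => [->//|/eqP->|->]; rewrite ?zU ?orbT.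
  have sub : U (w (i, j)) \subset y i |: H i j.
    by apply/subsetP => x xU; rewrite !inE xU !orbT.
  apply: reach_trans (reachW sub (leqnn _) (reachU _ _ vU)).
  exact: reach_sym (reachW sub (leqnn _) (reachU _ _ zU)).
have /fin_all_exists[q Hq] : forall ij : 'I_n * 'I_n, exists q : seq G, ij.1 != ij.2 ->
    [/\ path (@edge G) (y ij.1) (rcons q (y ij.2)), uniq q, size q < 6 * r + 3
      & forall v, v \in q -> v \in H ij.1 ij.2 :|: H ij.2 ij.1].
  move=> [i j] /=; have [eij|nij] := eqVneq i j; first by exists [::].
  have nw : w (i, j) != w (j, i) by rewrite (inj_eq winj) xpair_eqE (negPf nij).
  have [a [b [aU bU eab]]] := adjU _ _ nw.
  pose Z := [set y i; y j] :|: (H i j :|: H j i).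
  have s1 : y i |: H i j \subset Z.
    by rewrite /Z setUACA subsetUl.
  have s2 : y j |: H j i \subset Z.
    by rewrite /Z setUACA subsetUr.
  have reachZ : reach Z (6 * r + 3) (y i) (y j).
    have -> : 6 * r + 3 = (3 * r + 1) + (1 + (3 * r + 1)) by lia.
    apply: reach_trans (reachW s1 (leqnn _) (reachH _ _ _ aU)) _.
    apply: reach_trans (reach_edge _ _ eab) _.
    - by apply: (subsetP s1); rewrite !inE aU !orbT.
    - by apply: (subsetP s2); rewrite !inE bU !orbT.
    - exact/reach_sym/(reachW s2 (leqnn _) (reachH _ _ _ bU)).
  have [p [yp lp szp /allP pZ up]] := reach_uniq reachZ.
  case: (lastP p) yp lp szp pZ up => [|q v]; first by move=> _ /yinj e; rewrite e eqxx in nij.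
  rewrite last_rcons size_rcons => yp ev szp pZ; rewrite ev in yp pZ *.
  rewrite /= mem_rcons in_cons negb_or rcons_uniq => /andP[/andP[_ niq] /andP[njq uq]].
  exists q => _; split=> // x xq.
  have /setUP[|//] : x \in Z by apply: pZ; rewrite mem_rcons in_cons xq orbT.
  by move=> /set2P[] e; rewrite -e xq in niq njq.
exists y, (fun i j => q (i, j)); split=> //.
- by move=> i j nij; have [] := Hq (i, j) nij.
- move=> i j k nij; have [_ _ _ h] := Hq (i, j) nij; apply/negP => /h.
  by rewrite in_setU !(negPf (Hy _ _ _)).
- move=> i j i' j' v nij nij'.
  have [_ _ _ h] := Hq (i, j) nij; have [_ _ _ h'] := Hq (i', j') nij'.
  move=> /h + /h'; rewrite /= => /setUP[] vH /setUP[] vH';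
    have [-> ->] := Hdis _ _ _ _ _ vH vH'; by [left|right].
Qed.

Section ExactSubdivision.
Variables (G : sgraph) (n k : nat) (y : 'I_n -> G) (q : 'I_n -> 'I_n -> seq G).
Hypotheses (y_inj : injective y)
  (q_path : forall i j : 'I_n, i < j -> path (@edge G) (y i) (rcons (q i j) (y j)))
  (q_uniq : forall i j : 'I_n, i < j -> uniq (q i j))
  (q_size : forall i j : 'I_n, i < j -> size (q i j) = k)
  (q_y : forall i j h : 'I_n, i < j -> y h \notin q i j)
  (q_dis : forall (i j i' j' : 'I_n) v, i < j -> i' < j' ->
    v \in q i j -> v \in q i' j' -> i = i' /\ j = j').

Let point (i j : 'I_n) (s : nat) : G := nth (y i) (y i :: rcons (q i j) (y j)) s.

Let point0 i j : point i j 0 = y i. Proof. by []. Qed.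

Let pointl (i j : 'I_n) : i < j -> point i j k.+1 = y j.
Proof. by move=> lt; rewrite /point /= nth_rcons q_size // ltnn eqxx. Qed.

Let point_in (i j : 'I_n) s : i < j -> 0 < s < k.+1 ->
  point i j s = nth (y i) (q i j) s.-1 /\ point i j s \in q i j.
Proof.
move=> lt; case: s => // s /andP[_]; rewrite ltnS => lts.
by rewrite /point /= nth_rcons q_size // lts mem_nth // q_size.
Qed.

Let point_inj (i j i' j' : 'I_n) s s' : i < j -> i' < j' -> 0 < s < k.+1 ->
  s' <= k.+1 -> point i j s = point i' j' s' -> [/\ i = i', j = j' & s = s'].
Proof.
move=> lt lt' hs les' e; have [e1 h1] := point_in lt hs.
have [s0|s'_gt0] := posnP s'.
  by rewrite e s0 point0 (negPf (q_y _ _)) in h1.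
have [sl|nsl] := eqVneq s' k.+1.
  by rewrite e sl pointl // (negPf (q_y _ _)) in h1.
have hs' : 0 < s' < k.+1 by lia.
have [e2 h2] := point_in lt' hs'; rewrite -e in h2.
have [ei ej] := q_dis lt lt' h1 h2; rewrite -ei -ej in e e2 *; split=> //.
have : s.-1 == s'.-1.
  rewrite -(nth_uniq (y i) _ _ (q_uniq lt)) ?q_size //; try lia.
  by rewrite -e1 -e2 e.
lia.
Qed.

Let point_edge (i j : 'I_n) s : i < j -> s <= k ->
  edge (point i j s) (point i j s.+1).
Proof.
move=> lt les; have /(pathP (y i)) := q_path lt.
by rewrite size_rcons q_size // => /(_ s); apply.
Qed.

Definition subdivision_vertices : {set G} :=
  [set v | [exists i : 'I_n, exists j : 'I_n, exists s : 'I_k.+2,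
     (i < j) && (v == point i j s)]].

(** Only edges between consecutive points are kept: chords of [G] would create shortcuts. *)
Definition subdivision_edge : rel G := fun u v =>
  [exists i : 'I_n, exists j : 'I_n, exists s : 'I_k.+1, (i < j) &&
    (((u, v) == (point i j s, point i j s.+1)) ||
     ((v, u) == (point i j s, point i j s.+1)))].

Fact subdivision_edge_sym : symmetric subdivision_edge.
Proof.
by move=> u v; apply: eq_existsb => i; apply: eq_existsb => j;
  apply: eq_existsb => s; rewrite orbC.
Qed.

Let mem_point (i j : 'I_n) s : i < j -> s <= k.+1 ->
  point i j s \in subdivision_vertices.
Proof.
move=> lt les; rewrite inE; apply/existsP; exists i; apply/existsP; exists j.
by apply/existsP; exists (Ordinal (les : s < k.+2)); rewrite lt /=.
Qed.

Let subdivision_edgeP u v : subdivision_edge u v ->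
  exists (i j : 'I_n) s, [/\ i < j, s < k.+1 &
    (u = point i j s /\ v = point i j s.+1) \/
    (v = point i j s /\ u = point i j s.+1)].
Proof.
move=> /existsP[i /existsP[j /existsP[s /andP[lt /orP[]]]]] /eqP[-> ->];
  exists i, j, s; split=> //; by [left|right].
Qed.

Fact subdivision_edgeW u v : subdivision_edge u v ->
  [&& edge u v, u \in subdivision_vertices & v \in subdivision_vertices].
Proof.
move=> /subdivision_edgeP[i [j [s [lt lts [[-> ->]|[-> ->]]]]]].
  by rewrite !mem_point ?point_edge // ltnW.
by rewrite !mem_point 1?edge_sym ?point_edge // ltnW.
Qed.

Definition subdivision : subgraph G :=
  Subgraph subdivision_edge_sym subdivision_edgeW.

Lemma subdivided_clique_subgraph : 1 < n -> exists (S : subgraph G) pr pt,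
  @subdivided_clique (sgraph_of S) n k.+1 pr pt.
Proof.
move=> n_gt1; exists subdivision.
have mem_y i : y i \in subdivision_vertices.
  pose i0 := Ordinal (ltnW n_gt1); pose i1 := Ordinal n_gt1.
  have [e|] := posnP i.
    have lt : i < i1 by rewrite e.
    by rewrite -(point0 i i1) mem_point.
  by move=> lt; rewrite -(@pointl i0 i lt) mem_point.
pose pr i : sgraph_of subdivision := Sub (y i) (mem_y i).
(* The default [pr i] only makes the function total; for [i < j] and [s <= k.+1] the point is a
   vertex of the subdivision. *)
pose pt i j s : sgraph_of subdivision := insubd (pr i) (point i j s).
have vpt (i j : 'I_n) s : i < j -> s <= k.+1 -> val (pt i j s) = point i j s.
  by move=> lt les; rewrite val_insubd mem_point.
exists pr, pt; split.
- by move=> i j lt; apply: val_inj; rewrite vpt.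
- by move=> i j lt; apply: val_inj; rewrite vpt // pointl.
- by move=> i j /(congr1 val)/y_inj.
- move=> i j i' j' s s' lt lt' hs les' /(congr1 val).
  by rewrite !vpt //; [exact: point_inj | lia].
- move=> v; have := valP v; rewrite inE.
  move=> /existsP[i /existsP[j /existsP[s /andP[lt /eqP e]]]].
  have les : s <= k.+1 by rewrite -ltnS.
  by exists i, j, s; split=> //; apply: val_inj; rewrite vpt.
- move=> i j s lt lts; rewrite /= /sgraph_of_edge !vpt // 1?ltnW //.
  apply/existsP; exists i; apply/existsP; exists j; apply/existsP.
  by exists (Ordinal lts); rewrite lt eqxx.
- move=> u v /subdivision_edgeP[i [j [s [lt lts h]]]].
  exists i, j, s; split=> //.
  by case: h => -[e1 e2]; [left|right]; split; apply: val_inj; rewrite vpt // ltnW.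
Qed.

End ExactSubdivision.

Lemma bounded_1_cowitnesses_nowhere_dense (C : sgraph -> Prop) :
  subgraph_closed C -> bounded_1_cowitnesses C -> nowhere_dense C.
Proof.
move=> hC cow r; set L := 6 * r + 3.
(* The size of the clique depends on [c], while the length [l] comes out of that clique, so the
   maximum over all [l <= L] is taken beforehand. *)
have [c Hc] : exists c, forall l, l <= L -> forall G, C G ->
    exists Q : {set G}, cowitness 1 (l + l./2) [set: G] Q /\ #|Q| <= c.
  elim: L => [|L [c IH]].
    by have [c Hc] := cow 0; exists c => l; rewrite leqn0 => /eqP->.
  have [c' Hc'] := cow (L.+1 + L.+1./2); exists (maxn c c') => l.
  rewrite leq_eqVlt => /predU1P[->|/IH h] G CG.
    by have [Q [cQ szQ]] := Hc' G CG; exists Q; split=> //; rewrite leq_max szQ orbT.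
  by have [Q [cQ szQ]] := h G CG; exists Q; split=> //; rewrite leq_max szQ.
pose n := 3 * c.+1.
have [N hN] := ramsey_colors L n; have [t ht] := topological_clique r N.
exists t => G CG /ht[y [q [yinj qP qy qdis]]].
have [||k [s [ltk subs szs pws]]] := hN _ (fun i j => size (q i j)) (enum 'I_N).
- by rewrite -cardE card_ord.
- have := enum_uniq 'I_N; rewrite uniq_pairwise; apply: sub_pairwise => i j nij.
  by have [] := qP i j nij.
have us : uniq s := subseq_uniq subs (enum_uniq _).
have szs' : size s == n by rewrite szs.
pose g := tnth (Tuple szs').
have ginj : injective g by apply/tuple_uniqP.
have gne (i j : 'I_n) : i < j -> g i != g j by move=> lt; rewrite (inj_eq ginj) neq_ltn lt.
have [|||||||S [pr [pt SC]]] := @subdivided_clique_subgraph G n k (y \o g)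
    (fun i j => q (g i) (g j)).
- exact: inj_comp.
- by move=> i j /gne /qP[].
- by move=> i j /gne /qP[].
- by move=> i j lt; apply/eqP; exact: (pairwise_tnth (s := Tuple szs') pws lt).
- by move=> i j h /gne nij; exact: qy.
- move=> i j i' j' v lt lt' vq vq'.
  case: (qdis _ _ _ _ _ (gne _ _ lt) (gne _ _ lt') vq vq') => -[/ginj e /ginj e'] //.
  by rewrite e e' in lt; lia.
- by rewrite /n; lia.
have [Q [cQ szQ]] := Hc k.+1 ltk _ (hC _ S CG).
by have := subdivided_clique_cowitness SC (ltn0Sn _) (erefl n) cQ; rewrite ltnNge szQ.
Qed.

Theorem mainTheorem3 (C : sgraph -> Prop) (hC : subgraph_closed C) :
  (nowhere_dense C <-> bounded_cowitnesses C) /\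
  (bounded_cowitnesses C <-> bounded_1_cowitnesses C).
Proof.
have bc_b1 : bounded_cowitnesses C -> bounded_1_cowitnesses C.
  by move=> bc r; have [c Hc] := bc r 1; exists c => G CG; exact: Hc.
have b1_nd := bounded_1_cowitnesses_nowhere_dense hC.
have nd_bc := @nowhere_dense_bounded_cowitnesses C.
by split; split; auto.
Qed.
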